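(* Let $E=\{n_k\}_{k\ge1}\subseteq\mathbb{Z}$ and suppose that $n_{k+1}/n_k$ is an odd integer for all sufficiently large $k$. Then $\mathcal{C}_E(\mathbb{T})$ has real umap.
   Context: $\mathbb{T}=\{z\in\mathbb{C}:|z|=1\}$ with normalized Haar measure $m$. The $n_k$ are distinct. $\mathcal{C}_E(\mathbb{T})$ is the space of continuous functions $f:\mathbb{T}\to\mathbb{C}$ with $\widehat f(n)=\int f(z)z^{-n}\,dm(z)=0$ for all $n\notin E$, with the sup norm. A separable Banach space $Y$ has real umap (metric unconditional approximation property) if for every $\varepsilon>0$ there is a sequence $\{T_k\}_{k\ge1}$ of bounded finite-rank operators on $Y$ with $T_ky\to y$ for all $y\in Y$ such that, with $T_0=0$, $\|\sum_{k=1}^n\epsilon_k(T_k-T_{k-1})\|\le1+\varepsilon$ for all $n$ and all $\epsilon_k\in\{-1,1\}$. *)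

(* Defs.v *)
From HB Require Import structures.
From mathcomp Require Import all_boot all_order all_algebra.
From mathcomp Require Import complex.
From mathcomp Require Import all_classical all_reals all_analysis.
From mathcomp Require Import measurable_realfun.

Set Implicit Arguments.
Unset Strict Implicit.
Unset Printing Implicit Defensive.

Import Order.TTheory GRing.Theory Num.Theory numFieldNormedType.Exports.
Import Normc.

Local Open Scope classical_set_scope.
Local Open Scope complex_scope.
Local Open Scope ring_scope.

Section complex_topology.
Context {R : realType}.
Local Notation C := (R[i]^o).
Local Notation Re := (@complex.Re R).
Local Notation Im := (@complex.Im R).

Lemma normrcE (z : C) : `|z| = (normc z)%:C. Proof. by []. Qed.

Lemma normc_ge0 (z : R[i]) : 0 <= normc z.
Proof. by case: z => a b; exact: sqrtr_ge0. Qed.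

Lemma normc_le_ReIm (z : R[i]) : normc z <= `|Re z| + `|Im z|.
Proof.
case: z => a b /=.
rewrite -[leRHS]ger0_norm ?addr_ge0// -sqrtr_sqr ler_sqrt ?sqr_ge0//.
by rewrite sqrrD !real_normK ?num_real// lerD2r lerDl mulrn_wge0// mulr_ge0.
Qed.

Lemma Re_le_normc (z : R[i]) : `|Re z| <= normc z.
Proof.
case: z => a b /=.
by rewrite -sqrtr_sqr ler_sqrt ?addr_ge0 ?sqr_ge0// lerDl sqr_ge0.
Qed.

Lemma Im_le_normc (z : R[i]) : `|Im z| <= normc z.
Proof.
case: z => a b /=.
by rewrite -sqrtr_sqr ler_sqrt ?addr_ge0 ?sqr_ge0// lerDr sqr_ge0.
Qed.

Lemma Re_continuous : continuous (Re : C -> R).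
Proof.
move=> z; apply/(@cvgrPdist_lt _ _ _ (nbhs z)) => e e0.
have e0' : 0 < e%:C :> R[i] by rewrite ltcR.
apply: filterS (nbhsx_ballx z _ e0') => w.
rewrite -ball_normE /= normrcE ltcR; apply: le_lt_trans.
by rewrite -raddfB; exact: Re_le_normc.
Qed.

Lemma Im_continuous : continuous (Im : C -> R).
Proof.
move=> z; apply/(@cvgrPdist_lt _ _ _ (nbhs z)) => e e0.
have e0' : 0 < e%:C :> R[i] by rewrite ltcR.
apply: filterS (nbhsx_ballx z _ e0') => w.
rewrite -ball_normE /= normrcE ltcR; apply: le_lt_trans.
by rewrite -raddfB; exact: Im_le_normc.
Qed.

Lemma gt0_complexP (e : R[i]) : 0 < e -> exists2 r : R, 0 < r & e = r%:C.
Proof.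
case: e => a b; rewrite ltcE /= => /andP[/eqP b0 a0].
by exists a; rewrite // b0.
Qed.

Lemma cvg_complex (T : Type) (F : set_system T) {FF : Filter F}
    (f g : T -> R) (a b : R) :
  f @ F --> a -> g @ F --> b ->
  (fun x => f x +i* g x : C) @ F --> (a +i* b : C).
Proof.
move=> fa gb; apply/cvgrPdist_lt => _ /gt0_complexP[e e0 ->].
have e20 : 0 < e / 2 by rewrite divr_gt0.
near=> x; rewrite normrcE ltcR.
apply: (le_lt_trans (normc_le_ReIm _)) => /=.
rewrite (splitr e); apply: ltrD; near: x.
  by move/cvgrPdist_lt : fa; apply.
by move/cvgrPdist_lt : gb; apply.
Unshelve. all: by end_near. Qed.

Lemma complex_complete (F : set_system C) :
  ProperFilter F -> cauchy F -> cvg F.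
Proof.
move=> FF /cauchyP Fc.
have cauchyRI (p : C -> R) : (forall z w : C, `|p z - p w| <= normc (z - w)) ->
    exists a : R, p @ F --> a.
  move=> pn; apply/cvg_ex; apply: cauchy_cvg; apply: cauchy_exP => e e0.
  have e0' : 0 < e%:C :> R[i] by rewrite ltcR.
  have [z Fz] := Fc _ e0'; exists (p z).
  suff zp : ball z e%:C `<=` p @^-1` ball (p z) e by exact: filterS zp Fz.
  move=> w; rewrite /preimage -!ball_normE /= normrcE ltcR.
  exact: le_lt_trans.
have [a Fa] : exists c : R, Re @ F --> c.
  by apply: (cauchyRI Re) => z w; have := Re_le_normc (z - w); rewrite raddfB.
have [b Fb] : exists c : R, Im @ F --> c.
  by apply: (cauchyRI Im) => z w; have := Im_le_normc (z - w); rewrite raddfB.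
apply/cvg_ex; exists (a +i* b : C).
have idE : (fun z : C => Re z +i* Im z : C) = id by apply: funext; case.
by have := cvg_complex Fa Fb; rewrite idE; apply; exact: filter_filter.
Qed.

End complex_topology.

(* The unit circle, with the topology induced by the plane. *)
Definition circle (R : realType) : Type := [set z : R[i]^o | `|z| = 1].

HB.instance Definition _ (R : realType) := Topological.copy (circle R)
  (set_type [set z : R[i]^o | `|z| = 1]).

Section circle.
Context {R : realType}.
Local Notation C := (R[i]^o).

Definition circle_val (z : circle R) : C := \val z.

Lemma circle_val_continuous : continuous circle_val.
Proof. exact: initial_continuous. Qed.

Lemma norm_circle_val (z : circle R) : `|circle_val z| = 1.
Proof. exact: (set_mem (valP z)). Qed.

Lemma cos_sin_norm (t : R) : `|(cos t +i* sin t : C)| = 1.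
Proof. by rewrite normc_def /= cos2Dsin2 sqrtr1. Qed.

Definition expi (t : R) : circle R :=
  exist _ (cos t +i* sin t : C) (mem_set (cos_sin_norm t)).

HB.instance Definition _ := isPointed.Build (circle R) (expi 0).

Lemma expi_continuous : continuous expi.
Proof.
apply: continuous_comp_initial => t.
by apply: cvg_complex; [exact: continuous_cos|exact: continuous_sin].
Qed.

Lemma expi_surj (z : circle R) : exists2 t, t \in `[- pi, pi] & expi t = z.
Proof.
have := norm_circle_val z; rewrite normrcE => /complexI.
case: z => -[a b] abin; rewrite /circle_val /= => ab1.
have ab2 : a ^+ 2 + b ^+ 2 = 1.
  by rewrite -[LHS]sqr_sqrtr ?addr_ge0 ?sqr_ge0// ab1 expr1n.
have b2 : b ^+ 2 = 1 - a ^+ 2 by rewrite -ab2 addrAC subrr add0r.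
have a1 : -1 <= a <= 1.
  by rewrite -ler_norml -(@expr_le1 _ 2)// real_normK ?num_real// -ab2 lerDl sqr_ge0.
have /andP[ac0 acpi] : 0 <= acos a <= pi by rewrite acos_ge0 // acos_lepi.
exists (if 0 <= b then acos a else - acos a).
  rewrite in_itv /=; case: ifPn => _.
    by rewrite acpi andbT (le_trans _ ac0)// oppr_le0 pi_ge0.
  by rewrite lerN2 acpi (le_trans _ (pi_ge0 R))// oppr_le0.
apply: val_inj => /=; case: ifPn => b0.
  by rewrite acosK// sin_acos// -b2 sqrtr_sqr ger0_norm.
rewrite cosN sinN acosK// sin_acos// -b2 sqrtr_sqr ler0_norm ?opprK//.
by rewrite ltW// ltNge.
Qed.

Lemma circle_compact : compact [set: circle R].
Proof.
have -> : [set: circle R] = expi @` `[- pi, pi].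
  by apply/seteqP; split => // z _; have [t tI <-] := expi_surj z; exists t.
apply: continuous_compact; last exact: segment_compact.
exact/continuous_subspaceT/expi_continuous.
Qed.

End circle.

Notation borel_circle R := (g_sigma_algebraType (@open (circle R))).

Section haar.
Context {R : realType}.
Local Notation C := (R[i]^o).
Local Notation Re := (@complex.Re R).
Local Notation Im := (@complex.Im R).

Lemma measurable_expi : measurable_fun setT (expi : measurableTypeR R -> borel_circle R).
Proof.
apply: (@measurability _ _ _ (borel_circle R) _ _ (@open (circle R))) => //.
move=> _ [A oA <-]; rewrite setTI; apply: open_measurable.
by apply: open_comp => // x _; exact: expi_continuous.
Qed.

HB.instance Definition _ :=
  isMeasurableFun.Build _ _ _ _ (expi : measurableTypeR R -> borel_circle R) measurable_expi.

Lemma twopi_gt0 : 0 < 2 * pi :> R.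
Proof. by rewrite mulr_gt0// pi_gt0. Qed.

(* Normalized Haar measure on the Borel sets of the circle: the image of
   normalized Lebesgue measure on [0, 2 pi] under t |-> e^{it}. *)
Definition haar : probability (borel_circle R) R :=
  distribution (uniform_prob twopi_gt0) (expi : {mfun measurableTypeR R >-> borel_circle R}).

Definition integral_haar (f : circle R -> C) : C :=
  (\int[haar]_z Re (f z)) +i* (\int[haar]_z Im (f z)).

Definition fourier_coef (f : circle R -> C) (k : int) : C :=
  integral_haar (fun z => f z * circle_val z ^ (- k)).

End haar.
Section haar_theory.
Context {R : realType}.
Local Notation C := (R[i]^o).
Local Notation Re := (@complex.Re R).
Local Notation Im := (@complex.Im R).
Implicit Types (f g : circle R -> C) (h : circle R -> R).

Lemma continuous_circle_measurable h :
  continuous h -> measurable_fun setT (h : borel_circle R -> R).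
Proof.
move=> /continuousP ch; apply: (measurability _ (RGenOpens.measurableE R)).
move=> _ [_ [a [b ->] <-]]; rewrite setTI; apply: sub_sigma_algebra.
exact/ch/interval_open.
Qed.

Lemma continuous_circle_bounded h : continuous h ->
  exists M, forall z, `|h z| <= M.
Proof.
move=> ch; have : compact (h @` setT).
  by apply: continuous_compact; [exact/continuous_subspaceT|exact: circle_compact].
move=> /compact_bounded[M [_ hM]]; exists (M + 1) => z.
by apply: (hM (M + 1)); [rewrite ltrDl|exists z].
Qed.

Lemma continuous_circle_integrable h : continuous h ->
  (haar (R := R)).-integrable setT (EFin \o h).
Proof.
move=> ch; apply: measurable_bounded_integrable => //.
- by rewrite (le_lt_trans (probability_le1 _ _))// ltry.
- exact: continuous_circle_measurable.
- have [M hM] := continuous_circle_bounded ch.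
  exists M; split; first exact: num_real.
  by move=> x Mx z _; exact: le_trans (hM z) (ltW Mx).
Qed.

Lemma continuous_Re f : continuous f -> continuous (Re \o f).
Proof. by move=> cf z; apply: continuous_comp; [exact: cf|exact: Re_continuous]. Qed.

Lemma continuous_Im f : continuous f -> continuous (Im \o f).
Proof. by move=> cf z; apply: continuous_comp; [exact: cf|exact: Im_continuous]. Qed.

Lemma continuous_normc_bounded f : continuous f ->
  exists M, forall z, normc (f z) <= M.
Proof.
move=> cf; have [M fM] := continuous_circle_bounded (continuous_Re cf).
have [N fN] := continuous_circle_bounded (continuous_Im cf).
exists (M + N) => z; apply: le_trans (normc_le_ReIm _) _.
by apply: lerD; [exact: fM|exact: fN].
Qed.

Lemma normc_circle_exprz z (k : int) : normc (circle_val z ^ k) = 1 :> R.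
Proof.
apply: complexI; rewrite -normrcE.
case: k => n; first by rewrite normrX norm_circle_val expr1n.
by rewrite [LHS](normfV (circle_val z ^+ n.+1)) normrX norm_circle_val expr1n invr1.
Qed.

Lemma continuous_mulc (T : topologicalType) (u v : T -> C) :
  continuous u -> continuous v -> continuous (fun x => u x * v x : C).
Proof. by move=> cu cv x; apply: cvgM; [exact: cu|exact: cv]. Qed.

Lemma continuous_addc (T : topologicalType) (u v : T -> C) :
  continuous u -> continuous v -> continuous (fun x => u x + v x : C).
Proof. by move=> cu cv x; apply: cvgD; [exact: cu|exact: cv]. Qed.

Lemma continuous_invc (T : topologicalType) (u : T -> C) :
  (forall x, u x != 0) -> continuous u -> continuous (fun x => (u x)^-1 : C).
Proof. by move=> u0 cu x; apply: cvgV; [exact: u0|exact: cu]. Qed.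

Lemma circle_exprz_continuous (k : int) :
  continuous (fun z : circle R => circle_val z ^ k : C).
Proof.
have cX n : continuous (fun z : circle R => circle_val z ^+ n : C).
  elim: n => [|n IHn]; first exact: (@cst_continuous _ _ (1 : C)).
  under eq_fun do rewrite exprS.
  exact: (continuous_mulc circle_val_continuous IHn).
case: k => n; first exact: cX.
apply: (continuous_invc _ (cX n.+1)) => z.
by rewrite -normr_eq0 normrX norm_circle_val expr1n oner_neq0.
Qed.

Lemma continuous_fourier f k : continuous f ->
  continuous (fun z => f z * circle_val z ^ k : C).
Proof. by move=> cf; exact: (continuous_mulc cf (@circle_exprz_continuous k)). Qed.

Lemma integral_haarD f g : continuous f -> continuous g ->
  integral_haar (fun z => f z + g z) = integral_haar f + integral_haar g.
Proof.
move=> cf cg.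
have cRf := continuous_circle_integrable (continuous_Re cf).
have cIf := continuous_circle_integrable (continuous_Im cf).
have cRg := continuous_circle_integrable (continuous_Re cg).
have cIg := continuous_circle_integrable (continuous_Im cg).
rewrite /integral_haar; apply/eqP; rewrite eq_complex /=; apply/andP; split.
  by under eq_Rintegral do rewrite raddfD; rewrite RintegralD.
by under eq_Rintegral do rewrite raddfD; rewrite RintegralD.
Qed.

Lemma integral_haarZ (c : C) f : continuous f ->
  integral_haar (fun z => c * f z) = c * integral_haar f.
Proof.
move=> cf.
have cRf := continuous_circle_integrable (continuous_Re cf).
have cIf := continuous_circle_integrable (continuous_Im cf).
have iZ h (r : R) : continuous h ->
    (haar (R := R)).-integrable setT (EFin \o (fun z => r * h z)).
  move=> ch.
  exact: (integrableZl measurableT r (continuous_circle_integrable ch)).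
have cR := continuous_Re cf; have cI := continuous_Im cf.
case: c => a b; rewrite /integral_haar; apply/eqP.
rewrite eq_complex /=; apply/andP; split; apply/eqP.
  rewrite -!RintegralZl// -RintegralB//; [|exact: iZ|exact: iZ].
  by apply: eq_Rintegral => z _; case: (f z).
rewrite -!RintegralZl// -RintegralD//; [|exact: iZ|exact: iZ].
by apply: eq_Rintegral => z _; case: (f z).
Qed.

Lemma normc_integral_haar f (M : R) : continuous f ->
  (forall z, normc (f z) <= M) -> normc (integral_haar f) <= M + M.
Proof.
move=> cf fM.
have bnd h : continuous h -> (forall z, `|h z| <= M) ->
    `|\int[haar]_z h z| <= M.
  move=> ch hM; apply: le_trans (le_normr_Rintegral _ _) _ => //.
    exact: continuous_circle_integrable.
  have <- : \int[haar]_(z in [set: borel_circle R]) M = M.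
    rewrite Rintegral_cst//; transitivity (M * fine 1%E); last exact: mulr1.
    by congr (_ * fine _); exact: probability_setT.
  apply: le_Rintegral => //.
    exact/integrable_norm/continuous_circle_integrable.
  by apply: continuous_circle_integrable; exact: cst_continuous.
apply: le_trans (normc_le_ReIm _) _; apply: lerD; apply: bnd => [|z].
- exact: continuous_Re.
- exact: le_trans (Re_le_normc _) (fM z).
- exact: continuous_Im.
- exact: le_trans (Im_le_normc _) (fM z).
Qed.

Lemma fourier_coefD f g k : continuous f -> continuous g ->
  fourier_coef (f \+ g) k = fourier_coef f k + fourier_coef g k.
Proof.
move=> cf cg; rewrite /fourier_coef -integral_haarD; try exact: continuous_fourier.
by congr integral_haar; apply/funext => z; rewrite mulrDl.
Qed.

Lemma fourier_coefZ (c : C) f k : continuous f ->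
  fourier_coef (fun z => c * f z) k = c * fourier_coef f k.
Proof.
move=> cf; rewrite /fourier_coef -integral_haarZ; last exact: continuous_fourier.
by congr integral_haar; apply/funext => z; rewrite mulrA.
Qed.

End haar_theory.

Section C_E.
Context (R : realType) (E : set int).
Local Notation C := (R[i]^o).

Definition C_E_pred : {pred circle R -> C} :=
  mem [set f : circle R -> C |
        continuous f /\ forall k, ~ E k -> fourier_coef f k = 0].

Lemma C_E_submod_closed : submod_closed C_E_pred.
Proof.
split.
  rewrite inE /=; split; first exact: cst_continuous.
  have {1}-> : (0 : circle R -> C) = (fun z => (0 : C) * (0 : C)).
    by apply/funext => z; rewrite mul0r.
  by move=> k _; rewrite fourier_coefZ ?mul0r//; exact: cst_continuous.
move=> c f g /[!inE] -[cf f0] [cg g0].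
have ccf : continuous (fun z => c * f z : C).
  exact: (continuous_mulc (@cst_continuous (circle R) C c) cf).
split => [|k Ek]; first exact: (continuous_addc ccf cg).
by rewrite [LHS](fourier_coefD k ccf cg) fourier_coefZ// f0// g0// mulr0 addr0.
Qed.

HB.instance Definition _ :=
  GRing.isSubmodClosed.Build C (circle R -> C) C_E_pred C_E_submod_closed.

(* [circle R -> R[i]^o] already carries the topology of pointwise convergence;
   wrapping the subspace in a record lets it carry the sup norm instead. *)
Record C_E := MkC_E { C_E_fun :> circle R -> C; _ : C_E_fun \in C_E_pred }.

HB.instance Definition _ := [isSub for C_E_fun].
HB.instance Definition _ := [Choice of C_E by <:].
HB.instance Definition _ := [SubChoice_isSubLmodule of C_E by <:].

Lemma C_E_continuous (f : C_E) : continuous f.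
Proof. by case: f => f /= /[!inE] -[]. Qed.

Lemma C_E_fourier (f : C_E) k : ~ E k -> fourier_coef f k = 0.
Proof. by case: f => f /= /[!inE] -[_]; exact. Qed.

Definition sup_norm (f : C_E) : R := sup [set normc (f z) | z in setT].

Lemma normc_le_sup_norm (f : C_E) z : normc (f z) <= sup_norm f.
Proof.
apply: ub_le_sup; last by exists z.
have [M fM] := continuous_normc_bounded (@C_E_continuous f).
by exists M => _ [w _ <-].
Qed.

Lemma sup_norm_le (f : C_E) M : (forall z, normc (f z) <= M) -> sup_norm f <= M.
Proof.
move=> fM; apply: ge_sup; first by exists (normc (f point)), point.
by move=> _ [w _ <-].
Qed.

Lemma sup_normD (f g : C_E) : sup_norm (f + g) <= sup_norm f + sup_norm g.
Proof.
apply: sup_norm_le => z; apply: le_trans (le_normcD _ _) _.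
by apply: lerD; exact: normc_le_sup_norm.
Qed.

Lemma sup_normZ (c : C) (f : C_E) : sup_norm (c *: f) = normc c * sup_norm f.
Proof.
have le1 (a : C) (g : C_E) : sup_norm (a *: g) <= normc a * sup_norm g.
  apply: sup_norm_le => z; rewrite [leLHS](normcM a (g z)).
  by rewrite ler_wpM2l ?normc_ge0// normc_le_sup_norm.
apply/eqP; rewrite eq_le le1 /=; have [->|c0] := eqVneq c 0.
  rewrite normc0 mul0r; apply: le_trans (normc_le_sup_norm _ point).
  exact: normc_ge0.
have nc0 : 0 < normc c.
  by rewrite lt_neqAle normc_ge0 andbT eq_sym; apply: contra c0 => /eqP/eq0_normc->.
rewrite mulrC -ler_pdivlMr// -normcV mulrC.
by apply: le_trans (le1 _ _); rewrite scalerA mulVf// scale1r.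
Qed.

Lemma sup_norm_eq0 (f : C_E) : sup_norm f = 0 -> f = 0.
Proof.
move=> f0; apply: val_inj; apply/funext => z; apply: eq0_normc.
by apply/eqP; rewrite eq_le normc_ge0 andbT -[leRHS]f0 normc_le_sup_norm.
Qed.

(* The norm of a [normedModType R[i]] takes its values in [R[i]]. *)
Let norm (f : C_E) : R[i] := (sup_norm f)%:C.

Let ler_normD f g : norm (f + g) <= norm f + norm g.
Proof. by rewrite -rmorphD lecR sup_normD. Qed.

Let normrZ (c : R[i]) f : norm (c *: f) = `|c| * norm f.
Proof. by rewrite /norm sup_normZ rmorphM. Qed.

Let normr0_eq0 f : norm f = 0 -> f = 0.
Proof. by move=> /complexI/sup_norm_eq0. Qed.

HB.instance Definition _ :=
  Lmodule_isNormed.Build R[i] C_E ler_normD normrZ normr0_eq0.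

Lemma C_E_normE (f : C_E) : `|f| = (sup_norm f)%:C.
Proof. by []. Qed.

Lemma C_E_complete (F : set_system C_E) :
  ProperFilter F -> cauchy F -> cvg F.
Proof.
move=> FF /cauchyP Fc.
have {}Fc (e : R) : 0 < e -> exists f : C_E, F (fun h => sup_norm (f - h) < e).
  move=> e0; have e0' : 0 < e%:C :> R[i] by rewrite ltcR.
  have [f Ff] := Fc _ e0'; exists f; apply: filterS Ff => h.
  by rewrite -ball_normE /= C_E_normE ltcR.
have ev (f h : C_E) (e : R) z : sup_norm (f - h) < e -> normc (f z - h z) < e.
  by apply: le_lt_trans; exact: (normc_le_sup_norm (f - h)).
pose ev_at z (h : C_E) : C := h z.
have /choice[g Fg] z : exists c : C, ev_at z @ F --> c.
  apply/cvg_ex; apply: complex_complete.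
  apply: cauchy_exP => _ /gt0_complexP[e e0 ->].
  have [f Ff] := Fc _ e0; exists (f z).
  suff sub : (fun h => sup_norm (f - h) < e) `<=` ev_at z @^-1` ball (f z) e%:C.
    exact: filterS sub Ff.
  by move=> h fh; rewrite /preimage -ball_normE /= normrcE ltcR; exact: ev.
have gf (f : C_E) (e : R) z : F (fun h => sup_norm (f - h) < e) ->
    normc (f z - g z) <= e.
  move=> Ff; apply/ler_addgt0Pr => d d0.
  have d0' : 0 < d%:C :> R[i] by rewrite ltcR.
  have /cvgrPdist_lt/(_ _ d0') Fd := Fg z.
  have [h [fh]] := filter_ex (filterI Ff Fd).
  rewrite /= normrcE ltcR /ev_at => gh.
  rewrite -(subrKA (h z)); apply: le_trans (le_normcD _ _) _.
  by rewrite lerD// ?ltW ?ev// -normcN opprB.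
have approx (e : R) : 0 < e -> exists f : C_E,
    F (fun h => sup_norm (f - h) < e) /\ forall z, normc (f z - g z) <= e.
  by move=> e0; have [f Ff] := Fc _ e0; exists f; split => // z; exact: gf.
have cg : continuous (g : circle R -> C).
  move=> z; apply/(@cvgrPdist_lt _ _ _ (nbhs z)) => _ /gt0_complexP[e e0 ->].
  have e40 : 0 < e / 2 / 2 by rewrite !divr_gt0.
  have e20' : 0 < (e / 2)%:C :> R[i] by rewrite ltcR divr_gt0.
  have [f [_ fg]] := approx _ e40.
  have /(@cvgrPdist_lt _ _ _ (nbhs z))/(_ _ e20') := @C_E_continuous f z.
  apply: filterS => w; rewrite !normrcE !ltcR => fzw.
  rewrite -(subrKA (f w)) -(subrKA (f z) (g z)).
  apply: le_lt_trans (le_normcD _ _) _; apply: le_lt_trans (lerD (le_normcD _ _) (lexx _)) _.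
  rewrite addrAC (splitr e) {1}(splitr (e / 2)) ler_ltD// lerD//.
  by rewrite -normcN opprB.
have g0 k : ~ E k -> fourier_coef g k = 0.
  move=> Ek; apply: eq0_normc; apply/eqP; rewrite eq_le normc_ge0 andbT.
  apply/ler_addgt0Pr => e e0; rewrite add0r.
  have e20 : 0 < e / 2 by rewrite divr_gt0.
  have [f [_ fg]] := approx _ e20.
  have cNf : continuous (fun z => (-1) * f z : C).
    exact: (continuous_mulc (@cst_continuous (circle R) C _) (@C_E_continuous f)).
  have cgf := continuous_addc cNf cg.
  have -> : fourier_coef g k = fourier_coef (fun z => (-1) * f z + g z) k.
    rewrite [RHS](fourier_coefD k cNf cg) fourier_coefZ; last exact: C_E_continuous.
    by rewrite C_E_fourier// mulr0 add0r.
  rewrite (splitr e); apply: normc_integral_haar => [|z].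
    exact: continuous_fourier.
  rewrite normcM mulN1r addrC -normcN opprB.
  by rewrite normc_circle_exprz mulr1.
have gE : (g : circle R -> C) \in C_E_pred by rewrite inE.
apply/cvg_ex; exists (MkC_E gE); apply/cvgrPdist_lt => _ /gt0_complexP[e e0 ->].
have e20 : 0 < e / 2 by rewrite divr_gt0.
have [f [Ff fg]] := approx _ e20.
apply: filterS Ff => h fh; rewrite C_E_normE ltcR.
rewrite -(subrKA f); apply: le_lt_trans (sup_normD _ _) _.
rewrite (splitr e) ler_ltD//; apply: sup_norm_le => z.
by rewrite -normcN opprB; exact: fg.
Qed.

HB.instance Definition _ := Uniform_isComplete.Build C_E C_E_complete.

End C_E.

Definition bounded_operator (K : numFieldType) (Y : normedModType K)
    (T : Y -> Y) : Prop :=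
  exists M : K, forall y, `|T y| <= M * `|y|.

Definition finite_rank (K : numFieldType) (Y : lmodType K) (T : Y -> Y) : Prop :=
  exists (d : nat) (e : 'I_d -> Y),
    forall y, exists c : 'I_d -> K, T y = \sum_(i < d) c i *: e i.

(* The last clause says that the operator norm of the signed sum of differences
   is at most [1 + eps]. The separability of [Y] presupposed by the notion is
   not listed: for real or complex scalars it follows, since the countably many
   finite-dimensional ranges of the [T k] span a dense subspace. *)
Definition real_umap (K : numFieldType) (Y : completeNormedModType K) : Prop :=
  forall eps : K, 0 < eps ->
  exists T : nat -> {linear Y -> Y},
    [/\ forall y, T 0%N y = 0,
        forall k, bounded_operator (T k) /\ finite_rank (T k),
        forall y, T k y @[k --> \oo] --> y &
        forall (n : nat) (s : nat -> K), (forall k, s k = 1 \/ s k = -1) ->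
          forall y, `|\sum_(1 <= k < n.+1) s k *: (T k y - T k.-1 y)|
                    <= (1 + eps) * `|y|].

(* Main.v *)
(* For large l the frequencies n_k with k >= l are odd multiples of n_l, so the
   tail f_l = sum_(k >= l) a_k z^(n_k) of the Fourier series of f has period
   2 pi / n_l and changes sign under a rotation by pi / n_l. Rotations by
   multiples of 2 pi / n_(l+1) fix f_(l+1) and multiply a_l z^(n_l) by roots of
   unity of order at least 3, so the maximum of the real part gains a fixed
   multiple of |a_l| (if n_(l+1) = - n_l one treats the two frequencies
   together); iterating, sum |a_k| <= c ||f||, and the partial sums S_N f
   converge to f in norm.

   A sign sequence that is constant on blocks of frequencies and changes sign at
   the indices l_1 < l_2 < ... is approximated by the characters of the rotation
   through sum_j pi / n_(l_j): at n_k the error is at most a multiple of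
   sum_(l_j > k) |n_k / n_(l_j)|. Averaging over A shifted systems of blocks
   divides the error by A, because sum_(l > k) |n_k / n_l| is bounded
   independently of k. Hence the averages of A consecutive partial sums are the
   required operators. *)
Require Import Defs.
From HB Require Import structures.
From mathcomp Require Import all_boot all_order all_algebra.
From mathcomp Require Import complex.
From mathcomp Require Import all_classical all_reals all_analysis.
From mathcomp Require Import measurable_realfun.
From mathcomp Require Import ring lra zify.

Import Order.TTheory GRing.Theory Num.Theory numFieldNormedType.Exports.
Import Normc.

Local Open Scope classical_set_scope.
Local Open Scope ring_scope.

Set Implicit Arguments.
Unset Strict Implicit.

(** * The characters e^{ikt} of the circle and their Haar integrals *)

Section circle_exponential.
Variable R : realType.
Local Notation C := (R[i]^o).
Local Open Scope complex_scope.

Definition cis (x : R) : C := cos x +i* sin x.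

Lemma circle_val_expi x : circle_val (expi x) = cis x :> C.
Proof. by []. Qed.

Lemma cisD x y : cis (x + y) = cis x * cis y.
Proof.
rewrite /cis cosD sinD; apply/eqP; rewrite eq_complex /= eqxx /=; apply/eqP; ring.
Qed.

Lemma cis0 : cis 0 = 1.
Proof. by rewrite /cis cos0 sin0. Qed.

Lemma cispi : cis pi = -1.
Proof. by rewrite /cis cospi sinpi; apply/eqP; rewrite eq_complex /= oppr0 !eqxx. Qed.

Lemma cis2pi : cis (2 * pi) = 1.
Proof. by rewrite mulr_natl mulr2n cisD cispi mulrNN mulr1. Qed.

Lemma normc_cis x : normc (cis x) = 1.
Proof. by rewrite /= cos2Dsin2 sqrtr1. Qed.

Lemma cis_neq0 x : cis x != 0.
Proof.
by apply/eqP => c0; have := normc_cis x; rewrite c0 normc0 => /eqP; rewrite eq_sym oner_eq0.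
Qed.

Lemma cisN x : cis (- x) = (cis x)^-1.
Proof. by apply: (mulIf (cis_neq0 x)); rewrite -cisD addNr cis0 mulVf ?cis_neq0. Qed.

Lemma cisMn (k : nat) x : cis (k%:R * x) = cis x ^+ k.
Proof.
elim: k => [|k IH]; first by rewrite mul0r cis0 expr0.
by rewrite -natr1 mulrDl mul1r cisD IH exprSr.
Qed.

Lemma cisMz (k : int) x : cis (k%:~R * x) = cis x ^ k.
Proof.
case: k => k; first exact: cisMn.
by rewrite NegzE rmorphN mulNr cisN; congr (_ ^-1); exact: cisMn.
Qed.

Lemma cisMz_pi (q : int) : odd `|q|%N -> cis (q%:~R * pi) = -1.
Proof.
move=> oq; rewrite cisMz cispi; case: q oq => k /= ok.
  by rewrite -exprnP -signr_odd ok.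
rewrite (_ : (-1) ^ Negz k = ((-1) ^+ k.+1)^-1)// -signr_odd /= ok.
by rewrite expr1 invrN invr1.
Qed.

Lemma cisMz_2pi (q : int) : cis (q%:~R * (2 * pi)) = 1.
Proof. by rewrite cisMz cis2pi exp1rz. Qed.

Lemma norm_sin_le x : `|sin x| <= `|x| :> R.
Proof.
wlog x0 : x / 0 <= x.
  move=> H; have [/H//|/ltW x0] := leP 0 x.
  by rewrite -normrN -sinN -[leRHS]normrN H// oppr_ge0.
have [->|xn0] := eqVneq x 0; first by rewrite sin0.
have xp : 0 < x by rewrite lt_neqAle eq_sym xn0.
have [|c _] := @MVT R sin cos 0 x xp (fun c _ => is_derive_sin c).
  exact/continuous_subspaceT/continuous_sin.
rewrite sin0 !subr0 => ->; rewrite normrM ler_piMl//; exact: cos_max.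
Qed.

Lemma cos_ge_quad x : 1 - cos x <= `|x| :> R.
Proof.
wlog x0 : x / 0 <= x.
  move=> H; have [/H//|/ltW x0] := leP 0 x.
  by rewrite -cosN -[leRHS]normrN H// oppr_ge0.
have [->|xn0] := eqVneq x 0; first by rewrite cos0 subrr.
have xp : 0 < x by rewrite lt_neqAle eq_sym xn0.
have [|c _] := @MVT R cos (fun c => - sin c) 0 x xp (fun c _ => is_derive_cos c).
  exact/continuous_subspaceT/continuous_cos.
rewrite cos0 subr0 mulNr => h.
have -> : 1 - cos x = sin c * x by lra.
by rewrite (ger0_norm x0) ler_piMl// sin_le1.
Qed.

Lemma normc_cis_sub1 x : normc (cis x - 1) <= 2 * `|x|.
Proof.
apply: le_trans (normc_le_ReIm _) _ => /=.
rewrite oppr0 addr0 mulr_natl mulr2n lerD ?norm_sin_le//.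
by rewrite distrC ger0_norm ?cos_ge_quad// subr_ge0 cos_le1.
Qed.

(** Nonnegativity lets the change of variables along [expi] take place in the extended reals;
    finiteness is checked only at the end. *)
Lemma haar_ge0 (h : circle R -> R) : continuous h -> (forall z, 0 <= h z) ->
  \int[haar]_z h z =
  (2 * pi)^-1 * \int[lebesgue_measure]_(t in `[0, 2 * pi]) h (expi t).
Proof.
move=> ch h0; rewrite /Rintegral /haar.
have mh : measurable_fun setT (fun z : borel_circle R => (h z)%:E).
  by apply/measurable_EFinP; exact: continuous_circle_measurable.
have che : continuous (fun t : R => h (expi t)).
  by move=> t; apply: continuous_comp; [exact: expi_continuous|exact: ch].
rewrite ge0_integral_pushforward//; last by move=> z _; rewrite lee_fin.
rewrite preimage_setT integral_uniform; last 2 first.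
- by apply: measurableT_comp => //; exact: measurable_expi.
- by move=> x; rewrite lee_fin.
rewrite subr0 fineM//.
apply: integrable_fin_num => //.
apply: continuous_compact_integrable; first exact: segment_compact.
exact: continuous_subspaceT.
Qed.

Lemma haar_cst (c : R) : \int[haar (R:=R)]_(z in setT) c = c.
Proof.
rewrite Rintegral_cst//; transitivity (c * fine 1%E); last exact: mulr1.
by congr (_ * fine _); exact: probability_setT.
Qed.

(** The fundamental theorem of calculus is applied to [1 + h], which is nonnegative because [h] is
    bounded by 1; the mean 1 of the constant is subtracted afterwards. *)
Lemma haar_trig (f F : R -> R) (h : circle R -> R) :
  continuous h -> (forall t, h (expi t) = f t) -> (forall z, `|h z| <= 1) ->
  (forall t, is_derive t (1 : R) F (f t)) -> F (2 * pi) = F 0 ->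
  \int[haar]_z h z = 0.
Proof.
move=> ch hf h1 dF F2.
have ch1 : continuous (fun z => 1 + h z).
  by move=> z; apply: continuousD; [exact: cst_continuous|exact: ch].
have che : continuous f.
  move=> t; have -> : f = (fun t : R => h (expi t)) by apply/funext => u; rewrite hf.
  by apply: continuous_comp; [exact: expi_continuous|exact: ch].
have h1' z : 0 <= 1 + h z by have := h1 z; rewrite ler_norml => /andP[]; lra.
have dG (t : R) : is_derive t (1 : R) (fun t => t + F t) (1 + f t).
  by apply: is_deriveD.
have := haar_ge0 ch1 h1'.
rewrite /(Rintegral lebesgue_measure _ _) (_ : \int[_]_(x in _) _ = (2 * pi)%:E)%E; last first.
  under eq_integral do rewrite hf.
  rewrite (@continuous_FTC2 _ (fun t => 1 + f t) (fun t => t + F t) 0 (2 * pi)).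
  - by rewrite F2 -EFinB; congr EFin; ring.
  - exact: twopi_gt0.
  - by apply: continuous_subspaceT => x; apply: continuousD; [exact: cst_continuous|exact: che].
  - have dd (x : R) : derivable (fun t => t + F t) x 1 by have [] := dG x.
    have cd : continuous (fun t => t + F t).
      by move=> x; exact/differentiable_continuous/derivable1_diffP.
    split => //; first (apply: cvg_at_right_filter; exact: cd).
    by apply: cvg_at_left_filter; exact: cd.
  - by move=> x _; rewrite derive1E; have [] := dG x.
rewrite /= mulVf ?gt_eqF ?twopi_gt0// => e.
rewrite (_ : \int[haar]_z h z = \int[haar]_z (1 + h z) - \int[haar (R:=R)]_(z in setT) 1).
  by rewrite e haar_cst subrr.
rewrite -RintegralB//.
- by apply: eq_Rintegral => z _; rewrite addrAC subrr add0r.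
- exact: continuous_circle_integrable.
- by apply: continuous_circle_integrable; exact: cst_continuous.
Qed.

Lemma integral_haar_exprz (k : int) :
  integral_haar (fun z : circle R => circle_val z ^ k) = (k == 0)%:R.
Proof.
have [->|k0] := eqVneq k 0.
  by rewrite /integral_haar !haar_cst.
have kR : k%:~R != 0 :> R by rewrite intr_eq0.
have ck := @circle_exprz_continuous R k.
have nk (z : circle R) := @normc_circle_exprz R z k.
have kE t : circle_val (expi t) ^ k = cis (k%:~R * t) by rewrite cisMz.
apply/eqP; rewrite eq_complex /=; apply/andP; split; apply/eqP.
- apply: (@haar_trig (fun t => cos (k%:~R * t)) (fun t => sin (k%:~R * t) / k%:~R)).
  + exact: (continuous_Re ck).
  + by move=> t; rewrite kE.
  + by move=> z; rewrite -(nk z); exact: Re_le_normc.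
  + move=> t; apply: is_derive_eq.
    by rewrite /GRing.scale /=; field.
  + by rewrite mulr0 sin0; have := cisMz_2pi k; rewrite /cis => /(congr1 (@complex.Im R))/= ->; rewrite mul0r.
- apply: (@haar_trig (fun t => sin (k%:~R * t)) (fun t => - (cos (k%:~R * t) / k%:~R))).
  + exact: (continuous_Im ck).
  + by move=> t; rewrite kE.
  + by move=> z; rewrite -(nk z); exact: Im_le_normc.
  + move=> t; apply: is_derive_eq.
    by rewrite /GRing.scale /=; field.
  + by rewrite mulr0 cos0; have := cisMz_2pi k; rewrite /cis => /(congr1 (@complex.Re R))/= ->.
Qed.

End circle_exponential.

(** * Recovering a continuous function from its Fourier coefficients with powers of a peak
    function *)

Section peak_kernel.
Variable R : realType.
Local Notation C := (R[i]^o).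
Local Open Scope complex_scope.

Lemma round_period (y P : R) : 0 < P -> exists m : int, `|y + m%:~R * P| <= P / 2.
Proof.
move=> P0; exists (- Num.floor (y / P + 1 / 2)).
have /andP[] := floor_itv (y / P + 1 / 2).
set m := Num.floor _ => m1 m2.
have yE : y = (y / P) * P by rewrite divfK ?gt_eqF.
rewrite yE rmorphN mulNr -mulrBl normrM (gtr0_norm P0) mulrC ler_wpM2l ?(ltW P0)//.
rewrite rmorphD /= in m2; rewrite ler_norml; apply/andP; split; lra.
Qed.

Lemma expi_periodic (x : R) (m : int) : expi (x + m%:~R * (2 * pi)) = expi x.
Proof. by apply: val_inj; rewrite /= -!/(cis _) cisD cisMz_2pi mulr1. Qed.

(** An argument within [pi] of [t] keeps [|x - t|] in the interval where cosine is decreasing. *)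
Lemma expi_surj_near (t : R) (z : circle R) : exists2 x, `|x - t| <= pi & expi x = z.
Proof.
have [y _ yz] := expi_surj z.
have [m hm] := round_period (y - t) (twopi_gt0 (R := R)).
exists (y + m%:~R * (2 * pi)); last by rewrite expi_periodic.
rewrite addrAC; apply: le_trans hm _.
by rewrite mulrC mulKf// pnatr_eq0.
Qed.

(** At e^{ix} this is cos^2((x - t)/2), a trigonometric polynomial that reaches its maximum 1 only
    at e^{it}; its powers, divided by their means, form an approximate identity. *)
Definition peak (t : R) (z : circle R) : R :=
  (1 + complex.Re (circle_val z * cis (- t))) / 2.

Lemma peak_expi t x : peak t (expi x) = (1 + cos (x - t)) / 2.
Proof. by rewrite /peak circle_val_expi -cisD. Qed.

Lemma peak_itv t z : 0 <= peak t z <= 1.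
Proof.
have [x _ <-] := expi_surj z; rewrite peak_expi.
have := cos_le1 (x - t); have := cos_geN1 (x - t); lra.
Qed.

Lemma continuous_addr (T : topologicalType) (u v : T -> R) :
  continuous u -> continuous v -> continuous (fun x => u x + v x).
Proof. by move=> cu cv x; apply: cvgD; [exact: cu|exact: cv]. Qed.

Lemma continuous_subr (T : topologicalType) (u v : T -> R) :
  continuous u -> continuous v -> continuous (fun x => u x - v x).
Proof. by move=> cu cv x; apply: cvgB; [exact: cu|exact: cv]. Qed.

Lemma continuous_mulr (T : topologicalType) (u v : T -> R) :
  continuous u -> continuous v -> continuous (fun x => u x * v x).
Proof. by move=> cu cv x; apply: cvgM; [exact: cu|exact: cv]. Qed.

Lemma continuous_peak t : continuous (peak t).
Proof.
have c1 : continuous (fun z : circle R => circle_val z * cis (- t) : C).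
  apply: continuous_mulc; first exact: circle_val_continuous.
  exact: cst_continuous.
suff : continuous (fun z => (1 + complex.Re (circle_val z * cis (- t))) / 2) by [].
apply: continuous_mulr; last exact: cst_continuous.
by apply: continuous_addr; [exact: cst_continuous|exact: (continuous_Re c1)].
Qed.

Lemma continuous_peakX t n : continuous (fun z => peak t z ^+ n).
Proof.
elim: n => [|n IH]; first by under eq_fun do rewrite expr0; exact: cst_continuous.
under eq_fun do rewrite exprS.
exact: (continuous_mulr (@continuous_peak t) IH).
Qed.

Lemma continuous_real_complex (h : circle R -> R) : continuous h ->
  continuous (fun z => (h z)%:C : C).
Proof.
move=> ch z; have c0 : continuous (fun _ : circle R => 0 : R) by exact: cst_continuous.
exact: (cvg_complex (ch z) (c0 z)).
Qed.

(** With u = e^{i(x - t)} the peak is u^{-1} (1 + u)^2 / 4, and the binomial theorem expands (1 +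
    u)^{2n}. *)
Lemma peak_Laurent t n z : (peak t z ^+ n)%:C =
  4^-1 ^+ n * \sum_(i < (n + n).+1) 'C(n + n, i)%:R *
    (cis ((n%:Z - i%:Z)%:~R * t) * circle_val z ^ (- (n%:Z - i%:Z))) :> C.
Proof.
have [x _ <-] := expi_surj z; rewrite peak_expi circle_val_expi.
set u := cis (x - t).
have u0 : u != 0 := cis_neq0 _.
have uV : (cos (x - t))%:C = (u + u^-1) / 2 :> R[i].
  have -> : u + u^-1 = (cos (x - t))%:C + (cos (x - t))%:C.
    rewrite /u -cisN /cis cosN sinN; apply/eqP.
    by rewrite eq_complex /= subrr addr0 !eqxx.
  by field.
have -> : (((1 + cos (x - t)) / 2) ^+ n)%:C = (4^-1 * (u^-1 * (1 + u) ^+ 2)) ^+ n :> C.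
  rewrite rmorphXn rmorphM rmorphD fmorphV rmorph_nat rmorph1; congr (_ ^+ n).
  have alg (v : C) : v != 0 -> (1 + (v + v^-1) / 2) / 2 = 4^-1 * (v^-1 * (1 + v) ^+ 2).
    by move=> v0; field.
  by rewrite -alg//; congr ((1 + _) / _); exact: uV.
rewrite exprMn; congr (_ * _); rewrite exprMn -exprM mul2n -addnn exprDn mulr_sumr.
apply: eq_bigr => i _; rewrite expr1n mul1r -mulr_natl mulrCA; congr (_ * _).
rewrite -cisN -!cisMn -cisMz -!cisD; congr cis.
by rewrite rmorphN rmorphB /=; ring.
Qed.

Lemma normc_real (r : R) : normc r%:C = `|r|.
Proof. by rewrite /= expr0n addr0 sqrtr_sqr. Qed.

Lemma integral_haar_sum (F : nat -> circle R -> C) n :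
  (forall i, continuous (F i)) ->
  integral_haar (fun z => \sum_(i < n) F i z) = \sum_(i < n) integral_haar (F i).
Proof.
move=> cF.
have cS m : continuous (fun z => \sum_(i < m) F i z : C).
  elim: m => [|m IH].
    by under eq_fun do rewrite big_ord0; exact: cst_continuous.
  under eq_fun do rewrite big_ord_recr /=.
  exact: (continuous_addc IH (cF m)).
elim: n => [|n IH].
  rewrite big_ord0; under eq_fun do rewrite big_ord0.
  by rewrite /integral_haar !haar_cst.
by under eq_fun do rewrite big_ord_recr /=; rewrite (integral_haarD (cS n) (cF n)) IH big_ord_recr.
Qed.

Lemma normc_integral_haar_le (f : circle R -> C) (b : circle R -> R) :
  continuous f -> continuous b -> (forall z, normc (f z) <= b z) ->
  normc (integral_haar f) <= 2 * \int[haar]_z b z.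
Proof.
move=> cf cb fb.
have bnd h : continuous h -> (forall z, `|h z| <= b z) ->
    `|\int[haar]_z h z| <= \int[haar]_z b z.
  move=> ch hM; apply: le_trans (le_normr_Rintegral _ _) _ => //.
    exact: continuous_circle_integrable.
  apply: le_Rintegral => //.
    exact/integrable_norm/continuous_circle_integrable.
  exact: continuous_circle_integrable.
apply: le_trans (normc_le_ReIm _) _; rewrite mulr_natl mulr2n; apply: lerD; apply: bnd => [|z].
- exact: continuous_Re.
- exact: le_trans (Re_le_normc _) (fb z).
- exact: continuous_Im.
- exact: le_trans (Im_le_normc _) (fb z).
Qed.

(** The convolution of [h] with the n-th power of the peak, evaluated at e^{it} and not yet
    normalized. *)
Definition peak_mean (h : circle R -> C) t n : C :=
  integral_haar (fun z => h z * (peak t z ^+ n)%:C).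

Lemma peak_meanE h t n : continuous h ->
  peak_mean h t n = 4^-1 ^+ n * \sum_(i < (n + n).+1) 'C(n + n, i)%:R *
    (cis ((n%:Z - i%:Z)%:~R * t) * fourier_coef h (n%:Z - i%:Z)).
Proof.
move=> ch; rewrite /peak_mean.
have cF (i : nat) := continuous_fourier (k := - (n%:Z - i%:Z)) ch.
have cG (i : nat) : continuous (fun z => (4^-1 ^+ n * ('C(n + n, i)%:R * cis ((n%:Z - i%:Z)%:~R * t))) *
    (h z * circle_val z ^ (- (n%:Z - i%:Z)))).
  by apply: continuous_mulc; [exact: cst_continuous|exact: cF].
transitivity (integral_haar (fun z => \sum_(i < (n + n).+1)
    (4^-1 ^+ n * ('C(n + n, i)%:R * cis ((n%:Z - i%:Z)%:~R * t))) *
    (h z * circle_val z ^ (- (n%:Z - i%:Z))))).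
  congr integral_haar; apply/funext => z.
  rewrite peak_Laurent !mulr_sumr; apply: eq_bigr => i _.
  by ring.
rewrite (integral_haar_sum (F := fun i z => (4^-1 ^+ n * ('C(n + n, i)%:R * cis ((n%:Z - i%:Z)%:~R * t))) *
    (h z * circle_val z ^ (- (n%:Z - i%:Z)))))//.
rewrite mulr_sumr; apply: eq_bigr => i _.
by rewrite (integral_haarZ _ (cF i)) /fourier_coef -!mulrA.
Qed.

Definition peak_mass n : R := 'C(n + n, n)%:R / 4 ^+ n.

(** For the constant function 1, only the frequency-zero term i = n survives in [peak_meanE]. *)
Lemma integral_peakX t n : \int[haar]_z (peak t z ^+ n) = peak_mass n.
Proof.
have c1 : continuous (fun _ : circle R => 1 : C) by exact: (@cst_continuous (circle R) C 1).
have := peak_meanE (h := fun=> 1) t n c1.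
have f1 j : fourier_coef (fun _ : circle R => 1 : C) j = (j == 0)%:R.
  rewrite /fourier_coef -(oppr_eq0 j) -integral_haar_exprz; congr integral_haar.
  by apply/funext => z; rewrite mul1r.
have ln : (n < (n + n).+1)%N by rewrite ltnS leq_addr.
rewrite (bigD1 (Ordinal ln)) //= subrr mul0r cis0 f1 eqxx !mulr1 big1 ?addr0; last first.
  move=> i /eqP ni; rewrite f1 subr_eq0 (_ : _ == _ = false) ?mulr0//.
  by apply/eqP => -[nE]; apply: ni; apply: val_inj.
have -> : 4^-1 ^+ n * 'C(n + n, n)%:R = (peak_mass n)%:C :> C.
  by rewrite /peak_mass rmorphM fmorphV rmorphXn !rmorph_nat mulrC exprVn.
move=> /(congr1 (@complex.Re R)).
rewrite /peak_mean /= => <-.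
by apply: eq_Rintegral => z _; rewrite mul0r subr0 mul1r.
Qed.

Lemma peak_mass_gt0 n : 0 < peak_mass n.
Proof. by rewrite divr_gt0 ?exprn_gt0// ltr0n bin_gt0 leq_addr. Qed.

(** Consecutive masses have ratio (2n + 1)/(2n + 2), by the recursion of the central binomial
    coefficients. That the relative loss tends to 0 makes the kernel concentrate at its peak. *)
Lemma peak_massS n : peak_mass n - peak_mass n.+1 = peak_mass n / n.+1.*2%:R.
Proof.
have h : ('C(n.+1 + n.+1, n.+1) * n.+1 = 'C(n + n, n) * (2 * (2 * n + 1)))%N.
  have h1 := mul_bin_diag (n + n).+2 n.
  have h2 := mul_bin_down (n + n).+1 n.
  rewrite /= subSn ?leq_addr// addnK in h2.
  rewrite addnS addSn.
  have e : (n + n).+2 = (2 * n.+1)%N by lia.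
  rewrite [LHS]mulnC -h1 /= e -mulnA -h2; lia.
move/(congr1 (fun m : nat => m%:R : R)): h; rewrite !natrM natrD natrM => h.
have n0 : n.+1%:R != 0 :> R by rewrite pnatr_eq0.
have -> : peak_mass n.+1 = 'C(n + n, n)%:R * (2 * (2 * n%:R + 1)) / n.+1%:R / 4 ^+ n.+1.
  by rewrite -h mulfK.
rewrite /peak_mass exprS -muln2 natrM.
have p0 : 4 ^+ n != 0 :> R by rewrite expf_neq0// pnatr_eq0.
rewrite -natr1 in n0 *; by field; rewrite n0 p0.
Qed.

(* Korovkin's argument: the deviation of [h] from its value at the peak is
   dominated by [1 - peak], whose mean against [peak ^+ n] is
   [peak_mass n - peak_mass n.+1]. *)
Lemma peak_majorant (h : circle R -> C) t e : continuous h -> 0 < e ->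
  exists2 M : R, 0 <= M & forall z, normc (h z - h (expi t)) <= e + M * (1 - peak t z).
Proof.
move=> ch e0.
have [B hB] := continuous_normc_bounded ch.
have B0 : 0 <= B by apply: le_trans (normc_ge0 _) (hB (expi t)).
have che : continuous (fun x : R => h (expi x)).
  by move=> x; apply: continuous_comp; [exact: expi_continuous|exact: ch].
have e0' : 0 < e%:C :> R[i] by rewrite ltcR.
have /cvgrPdist_lt/(_ _ e0')/nbhs_ballP[d /= d0 hd] := che t.
(* The cap at [pi] keeps [d'] where cosine is decreasing. *)
pose d' := Num.min d pi.
have d'0 : 0 < d' by rewrite lt_min d0 pi_gt0.
have d'pi : d' <= pi by rewrite ge_min lexx orbT.
have cd : cos d' < 1.
  rewrite -(@cos0 R) ltr_cos// in_itv /=; last by rewrite (ltW d'0).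
  by rewrite lexx pi_ge0.
have cd0 : 0 < (1 - cos d') / 2 by rewrite divr_gt0// subr_gt0.
(* Outside the arc of radius [d'] the deviation is at most [B + B], while [1 - peak] is at least
   [(1 - cos d') / 2]. *)
exists ((B + B) / ((1 - cos d') / 2)) => [|z].
  by rewrite divr_ge0 ?(ltW cd0)// addr_ge0.
have [x xt <-] := expi_surj_near t z.
have p1 : 0 <= 1 - peak t (expi x) by have /andP[_] := peak_itv t (expi x); rewrite subr_ge0.
have [xd|dx] := ltP `|x - t| d'.
  apply: ler_wpDr.
    by rewrite mulr_ge0 // divr_ge0 ?(ltW cd0)// addr_ge0.
  have := hd x; rewrite /ball /= distrC => /(_ (lt_le_trans xd _)).
  rewrite ge_min lexx => /(_ isT).
  by rewrite normrcE ltcR -normcN opprB => /ltW.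
apply: ler_wpDl; first exact: ltW.
apply: le_trans (le_normcD _ _) _; rewrite normcN.
apply: le_trans (lerD (hB _) (hB _)) _.
rewrite -mulrA ler_peMr ?addr_ge0// mulrC ler_pdivlMr// mul1r peak_expi.
have : cos (x - t) <= cos d'.
  have -> : cos (x - t) = cos `|x - t|.
    have [h0|h0] := leP 0 (x - t); first by rewrite ger0_norm.
    by rewrite ltr0_norm// cosN.
  by rewrite leNgt ltr_cos ?in_itv /= ?(ltW d'0)// -?leNgt// ?normr_ge0.
lra.
Qed.

(** The majorant is integrated against [peak ^+ n] and divided by the mass. Estimating real and
    imaginary parts separately costs a factor 2, which explains [e / 2] and [2 * M] in the proof. *)
Lemma peak_mean_dist (h : circle R -> C) t e : continuous h -> 0 < e ->
  exists2 M : R, 0 <= M & forall n,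
    normc (peak_mean h t n / (peak_mass n)%:C - h (expi t)) <= e + M / n.+1.*2%:R.
Proof.
move=> ch e0; have e20 : 0 < e / 2 by rewrite divr_gt0.
have [M M0 hM] := peak_majorant t ch e20.
exists (2 * M) => [|n]; first by rewrite mulr_ge0.
have m0 := peak_mass_gt0 n.
have mC0 : (peak_mass n)%:C != 0 :> C.
  by apply/eqP => /complexI /eqP; rewrite gt_eqF.
have cp := continuous_real_complex (@continuous_peakX t n).
have cN : continuous (fun z => - h (expi t) * (peak t z ^+ n)%:C : C).
  by apply: continuous_mulc; [exact: cst_continuous|exact: cp].
have cD : continuous (fun z => (h z - h (expi t)) * (peak t z ^+ n)%:C : C).
  apply: continuous_mulc; last exact: cp.
  by apply: continuous_addc; [exact: ch|exact: cst_continuous].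
have mass : integral_haar (fun z => (peak t z ^+ n)%:C) = (peak_mass n)%:C :> C.
  by rewrite /integral_haar /= integral_peakX haar_cst.
have -> : peak_mean h t n / (peak_mass n)%:C - h (expi t) =
    integral_haar (fun z => (h z - h (expi t)) * (peak t z ^+ n)%:C) / (peak_mass n)%:C.
  apply: (mulIf mC0); rewrite (divfK mC0) mulrBl (divfK mC0) -mass -mulNr.
  rewrite -(integral_haarZ (- h (expi t)) cp) -(integral_haarD (continuous_mulc ch cp) cN).
  by congr integral_haar; apply/funext => z; rewrite mulrDl.
rewrite normcM normcV normc_real (gtr0_norm m0).
rewrite ler_pdivrMr//.
pose b z : R := (e / 2 + M * (1 - peak t z)) * peak t z ^+ n.
have bE z : b z = (e / 2 + M) * peak t z ^+ n - M * peak t z ^+ n.+1.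
  by rewrite /b exprS; ring.
have c1 : continuous (fun z => (e / 2 + M) * peak t z ^+ n).
  by apply: continuous_mulr; [exact: cst_continuous|exact: continuous_peakX].
have c2 : continuous (fun z => M * peak t z ^+ n.+1).
  by apply: continuous_mulr; [exact: cst_continuous|exact: continuous_peakX].
have cb : continuous b.
  have -> : b = (fun z => (e / 2 + M) * peak t z ^+ n - M * peak t z ^+ n.+1).
    by apply/funext => z; exact: bE.
  exact: (continuous_subr c1 c2).
apply: le_trans (normc_integral_haar_le cD cb _) _.
  move=> z; rewrite normcM.
  have /andP[p0 p1] := peak_itv t z.
  rewrite normc_real ger0_norm ?exprn_ge0//.
  by rewrite ler_wpM2r ?exprn_ge0.
under eq_Rintegral do rewrite bE.
rewrite RintegralB//; [|exact: continuous_circle_integrable..].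
rewrite !RintegralZl//; [|apply: continuous_circle_integrable; exact: continuous_peakX..].
rewrite !integral_peakX.
have := peak_massS n; move: (peak_mass n) (peak_mass n.+1) => a b' ab.
have -> : b' = a - a / n.+1.*2%:R by lra.
lra.
Qed.

(* With [c = 0] the hypothesis says that all Fourier coefficients vanish, and the
   conclusion is the uniqueness theorem. *)
Lemma fourier_rotation (h : circle R -> C) (c : C) s : continuous h ->
  (forall j, fourier_coef h j != 0 -> cis (j%:~R * s) = c) ->
  forall t, h (expi (t + s)) = c * h (expi t).
Proof.
move=> ch hc t.
(* In the finite expansion of the mean, rotation by [s] multiplies every term with a non-zero
   coefficient by the same [c]. *)
have hm n : peak_mean h (t + s) n = c * peak_mean h t n.
  rewrite !peak_meanE// mulrCA; congr (_ * _); rewrite mulr_sumr.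
  apply: eq_bigr => i _; set j := (n%:Z - i%:Z).
  rewrite [RHS]mulrCA; congr (_ * _).
  have [->|j0] := eqVneq (fourier_coef h j) 0; first by rewrite !mulr0.
  by rewrite mulrDr cisD (hc _ j0) [RHS]mulrA (mulrC c).
apply/eqP; rewrite -subr_eq0; apply/eqP/eq0_normc/eqP.
rewrite eq_le normc_ge0 andbT; apply/ler_addgt0Pr => e e0; rewrite add0r.
(* With this [e1] the fixed errors add up to [e / 2]; [n] below makes the terms in [M1] and [M2] add
   up to at most [e / 2]. *)
pose e1 := e / 2 / (1 + normc c).
have nc := normc_ge0 c.
have e10 : 0 < e1 by rewrite !divr_gt0// ltr_pwDl.
have [M1 M10 h1] := peak_mean_dist (t + s) ch e10.
have [M2 M20 h2] := peak_mean_dist t ch e10.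
pose n := Num.truncn ((M1 + normc c * M2) / (e / 2)).
have nn : (M1 + normc c * M2) / n.+1.*2%:R <= e / 2.
  rewrite ler_pdivrMr ?ltr0n ?double_gt0// [leRHS]mulrC -ler_pdivrMr ?divr_gt0//.
  apply: ltW; apply: lt_le_trans (truncnS_gt _) _.
  by rewrite ler_nat -/n -addnn leq_addr.
have := lerD (h1 n) (ler_wpM2l nc (h2 n)).
rewrite -normcM -normcN => hh.
set X := h _; set Y := h _.
have -> : X - c * Y = - (peak_mean h (t + s) n / (peak_mass n)%:C - X) +
    c * (peak_mean h t n / (peak_mass n)%:C - Y).
  by rewrite hm; ring.
apply: le_trans (le_normcD _ _) _; apply: le_trans hh _.
have e1E : e1 + normc c * e1 = e / 2 by rewrite /e1; field; rewrite gt_eqF// ltr_pwDl.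
rewrite mulrDr addrACA e1E mulrA -mulrDl; lra.
Qed.

Lemma fourier_uniqueness (h : circle R -> C) : continuous h ->
  (forall j, fourier_coef h j = 0) -> forall z, h z = 0.
Proof.
move=> ch h0 z; have [x _ <-] := expi_surj z.
have := @fourier_rotation h 0 0 ch _ x; rewrite addr0 mul0r; apply => j.
by rewrite h0 eqxx.
Qed.

End peak_kernel.

(** * Gain in the real part by rotation through roots of unity *)

Section gain.
Variable R : realType.
Local Notation C := (R[i]^o).
Local Open Scope complex_scope.

Lemma polar (c : C) : exists x : R, c = (normc c)%:C * cis x.
Proof.
have [->|c0] := eqVneq c 0; first by exists 0; rewrite normc0 mul0r.
have n0 : normc c != 0 by apply: contra c0 => /eqP/eq0_normc ->.
have nC0 : (normc c)%:C != 0 :> C by apply/eqP => /complexI /eqP; exact/negP.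
have h : `|(c / (normc c)%:C : C)| = 1.
  by rewrite normrcE normcM normcV normc_real ger0_norm ?normc_ge0// divff.
have [x _ xE] := expi_surj (exist _ (c / (normc c)%:C : C) (mem_set h) : circle R).
exists x; move/(congr1 circle_val): xE; rewrite circle_val_expi => ->.
by rewrite /circle_val /= mulrC divfK.
Qed.

Lemma cos_pi3_gt0 : 0 < cos (pi / 3) :> R.
Proof. by apply: cos_gt0_pihalf; have := pi_gt0 R; lra. Qed.

(** Steps of length 2 pi / |q| bring the argument of [c] within pi / |q| of 0, hence within pi /
    3. *)
Lemma root_of_unity_gain (q : int) (c : C) : (3 <= `|q|)%N ->
  exists m : int, cos (pi / 3) * normc c <=
    complex.Re (c * cis (m%:~R * (2 * pi / q%:~R))).
Proof.
move=> q3; have [x cE] := polar c.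
have pi0 := pi_gt0 R.
have Q3 : 3 <= `|q%:~R| :> R by rewrite -intr_norm -[3]/(3%:~R) ler_int; lia.
have Q0 : 0 < `|q%:~R| :> R by apply: lt_le_trans Q3.
have P0 : 0 < 2 * pi / `|q%:~R| :> R by rewrite divr_gt0// mulr_gt0.
have [m hm] := round_period x P0.
(* The sign turns a multiple of 2 pi / |q| into one of 2 pi / q. *)
exists (sgz q * m).
have -> : (sgz q * m)%:~R * (2 * pi / q%:~R) = m%:~R * (2 * pi / `|q%:~R|) :> R.
  have q0 : q%:~R != 0 :> R by rewrite -normr_gt0.
  have [qp|qn] := lerP 0 q.
    by rewrite ger0_norm ?ler0z// gtr0_sgz ?mul1r// lt_neqAle qp andbT; lia.
  by rewrite ltr0_norm ?ltrz0// ltr0_sgz// mulN1r rmorphN; field.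
rewrite {2}cE -(mulrA (normc c)%:C) -cisD.
set y := x + _ in hm *.
have -> : complex.Re ((normc c)%:C * cis y) = normc c * cos y.
  by rewrite /= mul0r subr0.
rewrite mulrC ler_wpM2l ?normc_ge0//.
have -> : cos y = cos `|y|.
  have [h0|h0] := leP 0 y; first by rewrite ger0_norm.
  by rewrite ltr0_norm// cosN.
have y3 : `|y| <= pi / 3.
  rewrite (_ : _ / 2 = pi / `|q%:~R|) in hm; last by field; rewrite gt_eqF.
  apply: le_trans hm _.
  by rewrite ler_pM2l// lef_pV2// posrE.
rewrite leNgt ltr_cos -?leNgt// in_itv /= ?normr_ge0//; lra.
Qed.

Lemma ReD (x y : C) : complex.Re (x + y) = complex.Re x + complex.Re y.
Proof. by case: x; case: y. Qed.

Lemma Re_conj_cis (c : C) x : complex.Re (c * cis (- x)) = complex.Re (conjc c * cis x).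
Proof. by case: c => a b; rewrite /cis cosN sinN /=; ring. Qed.

Lemma normc_conj (c : C) : normc (conjc c) = normc c.
Proof. by case: c => a b /=; rewrite sqrrN. Qed.

(* Real parts only see [a + conjc b] when the frequencies of [a] and [b] are
   opposite; testing ['i * f] as well as [f] recovers both moduli. *)
Lemma normc_add_conj (a b : C) : normc a + normc b <=
  normc (a + conjc b) + normc ('i * a + conjc ('i * b)).
Proof.
have -> : 'i * a + conjc ('i * b) = 'i * (a - conjc b).
  case: a b => [a1 a2] [b1 b2]; apply/eqP.
  by rewrite eq_complex /=; apply/andP; split; apply/eqP; ring.
have ni : normc ('i : C) = 1 by rewrite /= expr0n add0r expr1n sqrtr1.
rewrite normcM ni mul1r.
have h1 := le_normcD (a + conjc b) (a - conjc b).
have h2 := le_normcD (a + conjc b) (- (a - conjc b)).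
rewrite normcN in h2.
have e1 : a + conjc b + (a - conjc b) = 2%:C * a by rewrite rmorph_nat; ring.
have e2 : a + conjc b + - (a - conjc b) = 2%:C * conjc b by rewrite rmorph_nat; ring.
rewrite e1 e2 !normcM !normc_real !ger0_norm// normc_conj in h1 h2; lra.
Qed.

End gain.

#[local] Arguments fourier_coef : simpl never.
#[local] Arguments normc : simpl never.

(** * Partial sums and tails of Fourier series with spectrum in the range of [n] *)

Section partial_sums.
Variables (R : realType) (n : nat -> int).
Hypothesis n_inj : injective n.
Local Notation C := (R[i]^o).
Local Notation E := (C_E R (range n)).
Local Open Scope complex_scope.

Lemma exprz_in_C_E k : (fun z : circle R => circle_val z ^ n k) \in C_E_pred (range n).
Proof.
rewrite inE; split => [|j nj]; first exact: circle_exprz_continuous.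
rewrite /fourier_coef (_ : (fun z => _) = fun z : circle R => circle_val z ^ (n k - j)).
  rewrite integral_haar_exprz; case: eqP => // /eqP; rewrite subr_eq0 => /eqP kj.
  by case: nj; exists k.
apply/funext => z; rewrite expfzDr//.
by rewrite -normr_eq0 norm_circle_val oner_neq0.
Qed.

Definition chr k : E := MkC_E (exprz_in_C_E k).

Lemma chr_expi k t : chr k (expi t) = cis ((n k)%:~R * t).
Proof. by rewrite cisMz. Qed.

Lemma fourier_coef_chr k j : fourier_coef (chr k) j = (n k == j)%:R.
Proof.
rewrite /fourier_coef -subr_eq0 -integral_haar_exprz; congr integral_haar.
apply/funext => z; rewrite expfzDr//.
by rewrite -normr_eq0 norm_circle_val oner_neq0.
Qed.

Definition coef (f : E) k : C := fourier_coef f (n k).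

Lemma normc_fourier_coef_le (f : E) j : normc (fourier_coef f j) <= 2 * sup_norm f.
Proof.
rewrite mulr_natl mulr2n; apply: normc_integral_haar.
  exact: (continuous_fourier (C_E_continuous (f := f))).
by move=> z; rewrite normcM normc_circle_exprz mulr1 normc_le_sup_norm.
Qed.

Lemma fourier_coef_lin (a : C) (f g : E) j :
  fourier_coef (a *: f + g) j = a * fourier_coef f j + fourier_coef g j.
Proof.
have cf := C_E_continuous (f := f); have cg := C_E_continuous (f := g).
have caf : continuous (fun z => a * f z : C).
  by apply: continuous_mulc; [exact: cst_continuous|exact: cf].
by rewrite -(fourier_coefZ a j cf) -(fourier_coefD j caf cg).
Qed.

Lemma coef_lin (a : C) (f g : E) k : coef (a *: f + g) k = a * coef f k + coef g k.
Proof. exact: fourier_coef_lin. Qed.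

Definition psum N (f : E) : E := \sum_(k < N) coef f k *: chr k.

Lemma psumS N f : psum N.+1 f = psum N f + coef f N *: chr N.
Proof. by rewrite /psum big_ord_recr. Qed.

Lemma psum_expi N f t : psum N f (expi t) = \sum_(k < N) coef f k * cis ((n k)%:~R * t).
Proof.
elim: N => [|N IH]; first by rewrite /psum !big_ord0.
by rewrite psumS big_ord_recr /= -IH -chr_expi.
Qed.

Lemma fourier_coef_psum N f j :
  fourier_coef (psum N f) j = \sum_(k < N) coef f k * (n k == j)%:R.
Proof.
elim: N => [|N IH].
  rewrite /psum !big_ord0; have := fourier_coef_lin (-1) 0 0 j.
  by rewrite scaler0 add0r mulN1r addNr.
by rewrite psumS addrC fourier_coef_lin IH big_ord_recr /= fourier_coef_chr addrC.
Qed.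

Definition tail N (f : E) : E := f - psum N f.

(** Injectivity of [n] ensures that the partial sum removes each of the first N frequencies exactly
    once. *)
Lemma tail_neq0 N f j : fourier_coef (tail N f) j != 0 -> exists2 k, (N <= k)%N & j = n k.
Proof.
rewrite /tail addrC -scaleN1r fourier_coef_lin fourier_coef_psum.
have [[k _ kj]|nj] := pselect (range n j); last first.
  rewrite (C_E_fourier f nj) big1 ?mulr0 ?addr0 ?eqxx// => i _.
  by case: eqP => [ij|_]; [case: nj; exists i|rewrite mulr0].
have [Nk|kN] := leqP N k; first by exists k.
rewrite (bigD1 (Ordinal kN)) //= kj eqxx mulr1 big1 ?addr0.
  by rewrite /coef kj mulN1r addNr eqxx.
move=> i /eqP ik; rewrite -kj (inj_eq n_inj) (_ : _ == _ = false) ?mulr0//.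
by apply/eqP => e; apply: ik; apply: val_inj.
Qed.

Lemma tailS N f t :
  tail N f (expi t) = coef f N * cis ((n N)%:~R * t) + tail N.+1 f (expi t).
Proof.
rewrite -chr_expi /tail psumS.
have -> : (f - psum N f : E) = coef f N *: chr N + (f - (psum N f + coef f N *: chr N)).
  by rewrite opprD (addrA f) [RHS]addrC subrK.
by [].
Qed.

(** * Symmetries of the tails and absolute summability of the coefficients *)

Variable K : nat.
Hypothesis n_odd : forall k, (K <= k)%N ->
  n k != 0 /\ exists2 q : int, odd `|q|%N & n k.+1 = q * n k.

Lemma freq_neq0 k : (K <= k)%N -> n k != 0.
Proof. by move=> /n_odd[]. Qed.

Lemma freqR_neq0 k : (K <= k)%N -> (n k)%:~R != 0 :> R.
Proof. by move=> /freq_neq0; rewrite intr_eq0. Qed.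

Lemma freq_ratio l k : (K <= l)%N -> (l <= k)%N ->
  exists2 q : int, odd `|q|%N & n k = q * n l.
Proof.
move=> Kl; elim: k => [|k IH]; rewrite leq_eqVlt => /orP[/eqP <-|].
- by exists 1; rewrite ?mul1r.
- by [].
- by exists 1; rewrite ?mul1r.
rewrite ltnS => lk; have [q oq qE] := IH lk.
have [_ [p op ->]] := n_odd (leq_trans Kl lk).
by exists (p * q); rewrite ?abszM ?oddM ?op// qE mulrA.
Qed.

Lemma tail_periodic l f t (m : int) : (K <= l)%N ->
  tail l f (expi (t + m%:~R * (2 * pi / (n l)%:~R))) = tail l f (expi t).
Proof.
move=> Kl; rewrite (@fourier_rotation _ _ 1) ?mul1r//; first exact: C_E_continuous.
move=> j /tail_neq0[k lk ->]; have [q _ ->] := freq_ratio Kl lk.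
have -> : (q * n l)%:~R * (m%:~R * (2 * pi / (n l)%:~R)) = (q * m)%:~R * (2 * pi) :> R.
  by rewrite !intrM; field; exact: freqR_neq0.
exact: cisMz_2pi.
Qed.

Lemma tail_antiperiodic l f t : (K <= l)%N ->
  tail l f (expi (t + pi / (n l)%:~R)) = - tail l f (expi t).
Proof.
move=> Kl; rewrite (@fourier_rotation _ _ (-1)) ?mulN1r//; first exact: C_E_continuous.
move=> j /tail_neq0[k lk ->]; have [q oq ->] := freq_ratio Kl lk.
have -> : (q * n l)%:~R * (pi / (n l)%:~R) = q%:~R * pi :> R.
  by rewrite !intrM; field; exact: freqR_neq0.
exact: cisMz_pi.
Qed.

(** Injectivity excludes the quotient 1, and an odd quotient is then -1 or of modulus at least 3. *)
Lemma freq_step k : (K <= k)%N ->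
  (exists2 q : int, (3 <= `|q|)%N & n k.+1 = q * n k) \/ n k.+1 = - n k.
Proof.
move=> Kk; have [nk0 [q oq qE]] := n_odd Kk.
have q1 : q != 1.
  apply/eqP => q1; move: qE; rewrite q1 mul1r => /n_inj /eqP; rewrite eqn_leq; lia.
move: qE; have [->|qN1] := eqVneq q (-1) => qE; first by right; rewrite qE mulN1r.
left; exists q => //; lia.
Qed.

(** Two sign changes in a row would return to the frequency n_k, against injectivity. *)
Lemma freq_step2 k : (K <= k)%N -> n k.+1 = - n k ->
  exists2 q : int, (3 <= `|q|)%N & n k.+2 = q * n k.+1.
Proof.
move=> Kk e; have [//|e2] := freq_step (leqW Kk).
have : k.+2 = k by apply: n_inj; rewrite e2 e opprK.
lia.
Qed.

Local Notation kappa := (cos (pi / 3) : R).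

(** Rotation by multiples of 2 pi / n_(l+1) fixes the tail from l + 1 on and moves the term of index
    l through the |q|-th roots of unity. *)
Lemma tail_gain1 l f (g : C) t (q : int) : (K <= l)%N -> normc g = 1 ->
  (3 <= `|q|)%N -> n l.+1 = q * n l ->
  exists t1, complex.Re (g * tail l.+1 f (expi t)) + kappa * normc (coef f l) <=
    complex.Re (g * tail l f (expi t1)).
Proof.
move=> Kl g1 q3 qE; set a := coef f l.
have [m] := root_of_unity_gain (g * (a * cis ((n l)%:~R * t))) q3.
rewrite !normcM normc_cis g1 mulr1 mul1r => hm.
exists (t + m%:~R * (2 * pi / (n l.+1)%:~R)).
rewrite (tailS l) tail_periodic ?(leqW Kl)//.
move: (tail l.+1 f (expi t)) => r.
rewrite (mulrDr g) ReD [leLHS]addrC; apply: lerD; last exact: lexx.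
apply: le_trans hm _; rewrite -(mulrA g) -(mulrA a) -cisD.
have q0 : q%:~R != 0 :> R by rewrite intr_eq0; lia.
rewrite qE intrM (_ : _ + _ = (n l)%:~R * (t + m%:~R * (2 * pi / (q%:~R * (n l)%:~R)))) //.
by field; rewrite q0 freqR_neq0.
Qed.

(** In the real part, a term of frequency -n_l counts as its conjugate at frequency n_l, so the two
    opposite terms merge into one with coefficient [c]. *)
Lemma tail_gain2 l f (g : C) t (q : int) : (K <= l)%N ->
  n l.+1 = - n l -> (3 <= `|q|)%N -> n l.+2 = q * n l.+1 ->
  exists t1, complex.Re (g * tail l.+2 f (expi t)) +
      kappa * normc (g * coef f l + conjc (g * coef f l.+1)) <=
    complex.Re (g * tail l f (expi t1)).
Proof.
move=> Kl lE q3 qE; set a := coef f l; set b := coef f l.+1.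
set c := g * a + _.
(* Relative to n_l the frequency n_(l+2) is the multiple -q. *)
have q3' : (3 <= `|(- q)%R|)%N by rewrite abszN.
have [m] := root_of_unity_gain (c * cis ((n l)%:~R * t)) q3'.
rewrite !normcM normc_cis mulr1 => hm.
exists (t + m%:~R * (2 * pi / (n l.+2)%:~R)).
rewrite (tailS l) (tailS l.+1) tail_periodic ?(leqW (leqW Kl))// lE rmorphN mulNr.
set x := (n l)%:~R * _.
have -> : complex.Re (g * (a * cis x + (b * cis (- x) + tail l.+2 f (expi t)))) =
   complex.Re (g * tail l.+2 f (expi t)) + complex.Re (c * cis x).
  rewrite !mulrDr !mulrA !ReD Re_conj_cis /c mulrDl ReD; ring.
rewrite lerD2l; apply: le_trans hm _; rewrite -mulrA -cisD.
have q0 : q%:~R != 0 :> R by rewrite intr_eq0; lia.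
rewrite (_ : _ + _ = x)// /x qE lE !intrM !rmorphN /=.
by field; rewrite q0 freqR_neq0.
Qed.

(** Antiperiodicity provides opposite values at two points. This starts the induction of gains. *)
Lemma tail_Re_ge0 l f (g : C) : (K <= l)%N -> exists t, 0 <= complex.Re (g * tail l f (expi t)).
Proof.
move=> Kl; have [h|/ltW h] := leP 0 (complex.Re (g * tail l f (expi 0))).
  by exists 0.
by exists (0 + pi / (n l)%:~R); rewrite tail_antiperiodic// mulrN raddfN /= oppr_ge0.
Qed.

(** Induction consumes one frequency, or an opposite pair. The test by ['i] accompanies the test by
    1 because a pair yields both moduli only through [normc_add_conj]. *)
Lemma tail_gain_sum d : forall l f, (K <= l)%N -> exists t t',
  kappa * \sum_(k < d) normc (coef f (l + k)) <=
  complex.Re (1 * tail l f (expi t)) + complex.Re ('i * tail l f (expi t')).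
Proof.
have k0 := cos_pi3_gt0 R.
have ni : normc ('i : C) = 1 by rewrite /normc /= expr0n add0r expr1n sqrtr1.
have n1 : normc (1 : C) = 1 by rewrite normc1.
elim/ltn_ind: d => -[_|d IH] l f Kl.
  have [t ht] := tail_Re_ge0 f 1 Kl; have [t' ht'] := tail_Re_ge0 f 'i Kl.
  by exists t, t'; rewrite big_ord0 mulr0 addr_ge0.
have [[q q3 qE]|lE] := freq_step Kl.
  have [t [t' h]] := IH d (ltnSn d) l.+1 f (leqW Kl).
  have [t1 h1] := tail_gain1 f t Kl n1 q3 qE.
  have [t2 h2] := tail_gain1 f t' Kl ni q3 qE.
  exists t1, t2; rewrite big_ord_recl addn0.
  rewrite (eq_bigr (fun k : 'I_d => normc (coef f (l.+1 + k)))); last first.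
    by move=> k _; rewrite /= /bump /= add1n addnS.
  (* Both tests gain the modulus of the coefficient, and one gain is dropped. *)
  have := mulr_ge0 (ltW k0) (normc_ge0 (coef f l)); lra.
have [q q3 qE] := freq_step2 Kl lE.
have hab := normc_add_conj (coef f l) (coef f l.+1).
have {}hab := ler_wpM2l (ltW k0) hab.
have gain d' : (d' <= d)%N -> exists t t',
  kappa * \sum_(k < d'.+2) normc (coef f (l + k)) <=
  complex.Re (1 * tail l f (expi t)) + complex.Re ('i * tail l f (expi t')).
  move=> dd; have [t [t' h]] := IH d' dd l.+2 f (leqW (leqW Kl)).
  have [t1 h1] := tail_gain2 f 1 t Kl lE q3 qE.
  have [t2 h2] := tail_gain2 f 'i t' Kl lE q3 qE.
  exists t1, t2; rewrite big_ord_recl addn0 big_ord_recl /bump /= addn1.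
  rewrite (eq_bigr (fun k : 'I_d' => normc (coef f (l.+2 + k)))); last first.
    by move=> k _; rewrite /= /bump /= !add1n !addnS.
  rewrite !mul1r in h1; rewrite !mul1r in h *; lra.
(* If a single coefficient is left but belongs to an opposite pair, its partner is included and then
   discarded. *)
case: d IH gain => [_|d _] gain; last by apply: gain.
have [t [t' h]] := gain 0%N (leqnn _).
exists t, t'; apply: le_trans h; apply: ler_wpM2l; first exact: ltW.
by rewrite [leRHS]big_ord_recr /= lerDl normc_ge0.
Qed.

Lemma sup_norm_chr k : sup_norm (chr k) <= 1.
Proof. by apply: sup_norm_le => z; rewrite normc_circle_exprz. Qed.

Lemma sup_norm_psum N f : sup_norm (psum N f) <= \sum_(k < N) normc (coef f k).
Proof.
elim: N => [|N IH].
  rewrite /psum !big_ord0; apply: sup_norm_le => z.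
  by rewrite [X in normc X](_ : _ = 0) ?normc0.
rewrite psumS big_ord_recr /=; apply: le_trans (sup_normD _ _) _.
by apply: lerD => //; rewrite sup_normZ ler_piMr ?normc_ge0// sup_norm_chr.
Qed.

(* The frequencies form a Sidon set. *)
Lemma coef_summable : exists2 c : R, 0 <= c &
  forall f N, \sum_(k < N) normc (coef f k) <= c * sup_norm f.
Proof.
have k0 := cos_pi3_gt0 R.
pose B : R := K%:R * 2.
have headB f : \sum_(k < K) normc (coef f k) <= B * sup_norm f.
  apply: le_trans (_ : \sum_(k < K) 2 * sup_norm f <= _).
    by apply: ler_sum => k _; exact: normc_fourier_coef_le.
  by rewrite sumr_const card_ord /B -mulrA (mulr_natl _ K).
(* [B] accounts for the first K coefficients; the tail has norm at most [(1 + B) * sup_norm f] and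
   is tested twice. *)
exists (B + 2 * (1 + B) / kappa) => [|f N].
  by rewrite addr_ge0 ?divr_ge0 ?mulr_ge0 ?addr_ge0 ?(ltW k0)// /B mulr_ge0.
have f0 : 0 <= sup_norm f by apply: le_trans (normc_le_sup_norm f point); exact: normc_ge0.
have [t [t' h]] := tail_gain_sum N f (leqnn K).
have bnd (g : C) x : normc g = 1 -> complex.Re (g * tail K f (expi x)) <= (1 + B) * sup_norm f.
  move=> g1; apply: le_trans (ler_norm _) _; apply: le_trans (Re_le_normc _) _.
  rewrite normcM g1 mul1r; apply: le_trans (normc_le_sup_norm _ _) _.
  apply: le_trans (sup_normD _ _) _; rewrite -scaleN1r sup_normZ normcN normc1 mul1r mulrDl mul1r.
  by rewrite lerD2l; apply: le_trans (sup_norm_psum _ _) (headB f).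
have ni : normc ('i : C) = 1 by rewrite /normc /= expr0n add0r expr1n sqrtr1.
have h1 := bnd 1 t (normc1 _); have h2 := bnd 'i t' ni.
apply: le_trans (_ : \sum_(k < K + N) normc (coef f k) <= _).
  rewrite addnC big_split_ord /= lerDl; apply: sumr_ge0 => k _; exact: normc_ge0.
rewrite big_split_ord /= mulrDl; apply: lerD; first exact: headB.
rewrite mulrAC ler_pdivlMr// mulrC; lra.
Qed.

End partial_sums.

(** * Convergence of partial sums and growth of the frequencies *)

Section umap.
Variables (R : realType) (n : nat -> int).
Hypothesis n_inj : injective n.
Variable K : nat.
Hypothesis n_odd : forall k, (K <= k)%N ->
  n k != 0 /\ exists2 q : int, odd `|q|%N & n k.+1 = q * n k.
Local Notation C := (R[i]^o).
Local Notation E := (C_E R (range n)).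
Local Open Scope complex_scope.

Lemma sup_norm_ge0 (f : E) : 0 <= sup_norm f.
Proof. by apply: le_trans (normc_le_sup_norm f point); exact: normc_ge0. Qed.

Lemma sup_normN (f : E) : sup_norm (- f) = sup_norm f.
Proof. by rewrite -scaleN1r sup_normZ normcN normc1 mul1r. Qed.

Lemma psum_add N d (f : E) :
  sup_norm (psum N f - psum (N + d) f) <= \sum_(k < d) normc (coef f (N + k)).
Proof.
elim: d => [|d IH].
  rewrite addn0 subrr big_ord0; apply: sup_norm_le => z.
  by rewrite [X in normc X](_ : _ = 0) ?normc0.
rewrite addnS psumS opprD addrA big_ord_recr /=; apply: le_trans (sup_normD _ _) _.
by apply: lerD => //; rewrite sup_normN sup_normZ ler_piMr ?normc_ge0// sup_norm_chr.
Qed.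

(** Summable coefficients make the partial sums Cauchy. Their limit has the Fourier coefficients of
    [f], hence equals [f] by uniqueness. *)
Lemma psum_cvg (f : E) e : 0 < e ->
  exists N0, forall N, (N0 <= N)%N -> sup_norm (f - psum N f) < e.
Proof.
have [c c0 hc] := coef_summable R n_inj n_odd.
pose a N := \sum_(k < N) normc (coef f k).
have a_nd : nondecreasing_seq a.
  apply/nondecreasing_seqP => N; rewrite /a big_ord_recr /= lerDl; exact: normc_ge0.
have a_cvg : cvgn a.
  apply: nondecreasing_is_cvgn => //.
  by exists (c * sup_norm f) => _ [N _ <-]; exact: hc.
pose u : nat -> E := fun N => psum N f.
have uc : cvg (u @ \oo).
  apply: C_E_complete; apply/cauchyP => _ /gt0_complexP[d d0 ->].
  have /cvgrPdist_lt/(_ _ d0)[N0 _ hN0] := a_cvg.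
  exists (u N0); exists N0 => // N /= NN0.
  rewrite -ball_normE /= C_E_normE ltcR /u -(subnKC NN0).
  apply: le_lt_trans (psum_add _ _ _) _.
  have := hN0 N0 (leqnn _); rewrite /=.
  have aN : a N <= limn a by exact: nondecreasing_cvgn_le.
  have aE : a N = a N0 + \sum_(k < N - N0) normc (coef f (N0 + k)).
    by rewrite /a -[in LHS](subnKC NN0) big_split_ord.
  have aN0 : a N0 <= limn a by exact: nondecreasing_cvgn_le.
  rewrite ger0_norm ?subr_ge0//; lra.
have [g ug] := (cvg_ex _).1 uc.
have ev d : 0 < d -> exists N0, forall N, (N0 <= N)%N -> sup_norm (g - psum N f) < d.
  move=> d0; have d0' : 0 < d%:C :> R[i] by rewrite ltcR.
  have /cvgrPdist_lt/(_ _ d0')[N0 _ hN0] := ug.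
  by exists N0 => N NN0; have := hN0 N NN0; rewrite /= C_E_normE ltcR.
suff fg : f = g.
  by move=> e0; have [N0 hN0] := ev _ e0; exists N0 => N NN0; rewrite [X in X - _]fg hN0.
apply/eqP; rewrite -subr_eq0; apply/eqP/val_inj/funext => z.
apply: (fourier_uniqueness (h := f - g)); first exact: C_E_continuous.
move=> j; apply/eq0_normc/eqP; rewrite eq_le normc_ge0 andbT.
apply/ler_addgt0Pr => d d0; rewrite add0r.
have d20 : 0 < d / 2 by rewrite divr_gt0.
have [N0 hN0] := ev _ d20.
(* Each fixed frequency drops out of the tail eventually, whether or not it belongs to the
   spectrum. *)
have [N1 hN1] : exists N1, forall N, (N1 <= N)%N -> fourier_coef (tail N f) j = 0.
  have [[k _ kj]|nj] := pselect (range n j); last first.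
    exists 0%N => N _; apply/eqP; apply: contra_notT nj => /(tail_neq0 n_inj)[k _ ->].
    by exists k.
  exists k.+1 => N kN; apply/eqP; apply: contraT => /(tail_neq0 n_inj)[k' Nk' k'j].
  move: k'j; rewrite -kj => /n_inj kk'; move: kN; rewrite kk' ltnNge Nk'; done.
pose N := maxn N0 N1.
have -> : f - g = 1 *: tail N f + (- (g - psum N f)).
  by rewrite scale1r /tail opprB addrA subrK.
rewrite fourier_coef_lin hN1 ?leq_maxr// mulr0 add0r.
apply: le_trans (normc_fourier_coef_le _ _) _.
rewrite sup_normN; have := hN0 N (leq_maxl _ _); lra.
Qed.

Lemma freq_norm_ge1 k : (K <= k)%N -> 1 <= `|(n k)%:~R| :> R.
Proof.
move=> /n_odd[nk0 _]; rewrite -intr_norm -[1]/(1%:~R) ler_int; lia.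
Qed.

Lemma freq_norm_le l k : (K <= l)%N -> (l <= k)%N -> `|(n l)%:~R| <= `|(n k)%:~R| :> R.
Proof.
move=> Kl lk; have [q oq ->] := freq_ratio n_odd Kl lk.
rewrite intrM normrM ler_peMl// -intr_norm -[1]/(1%:~R) ler_int; lia.
Qed.

(** Two steps are taken because one of them, but not both, may be a mere change of sign. *)
Lemma freq_norm_growth l : (K <= l)%N -> 3 * `|(n l)%:~R| <= `|(n l.+2)%:~R| :> R.
Proof.
move=> Kl; have three (q : int) : (3 <= `|q|)%N -> 3 <= `|q%:~R| :> R.
  by move=> q3; rewrite -intr_norm -[3]/(3%:~R) ler_int; lia.
have [[q q3 qE]|lE] := freq_step n_inj n_odd Kl.
  apply: le_trans (freq_norm_le (leqW Kl) (leqnSn _)).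
  by rewrite qE intrM normrM ler_wpM2r// three.
have [q q3 ->] := freq_step2 n_inj n_odd Kl lE.
by rewrite lE intrM rmorphN normrM normrN ler_wpM2r// three.
Qed.

(** The first two terms are at most 2 / |n_l| and the rest, by induction, at most 3 / |n_(l+2)|,
    thus 1 / |n_l|; the constant 3 solves c = 2 + c / 3. *)
Lemma sum_freq_inv l d : (K <= l)%N ->
  \sum_(i < d) `|(n (l + i))%:~R|^-1 <= 3 * `|(n l)%:~R|^-1 :> R.
Proof.
have pos k : (K <= k)%N -> 0 < `|(n k)%:~R| :> R.
  by move=> /freq_norm_ge1; apply: lt_le_trans.
elim/ltn_ind: d l => -[_|[_|d IH]] l Kl; have n0 := pos _ Kl.
- by rewrite big_ord0 mulr_ge0// invr_ge0 ltW.
- rewrite big_ord1 addn0; have : 0 < `|(n l)%:~R|^-1 :> R by rewrite invr_gt0.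
  lra.
rewrite big_ord_recl addn0 big_ord_recl /=.
rewrite (eq_bigr (fun k : 'I_d => `|(n (l.+2 + k))%:~R|^-1)); last first.
  by move=> k _; rewrite /= /bump /= !add1n !addnS.
have h1 := IH d (ltnW (ltnSn _)) l.+2 (leqW (leqW Kl)).
have h2 : `|(n (l + bump 0 0))%:~R|^-1 <= `|(n l)%:~R|^-1 :> R.
  rewrite lef_pV2 ?posrE//; last exact: (pos _ (leq_trans Kl (leq_addr _ _))).
  exact: freq_norm_le (leq_addr _ _).
have h3 : `|(n l.+2)%:~R|^-1 <= (3 * `|(n l)%:~R|)^-1 :> R.
  rewrite lef_pV2 ?posrE; [exact: freq_norm_growth| |by rewrite mulr_gt0].
  exact: (pos _ (leqW (leqW Kl))).
rewrite invfM in h3; lra.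
Qed.

(* Bounds the distance from 1 of the rotation by pi / n_l at frequency n_k. *)
Definition rel_freq k l : R :=
  if (k < l)%N then 2 * pi * `|(n k)%:~R| / `|(n l)%:~R| else 0.

Lemma rel_freq_ge0 k l : 0 <= rel_freq k l.
Proof. by rewrite /rel_freq; case: ifP => // _; rewrite !mulr_ge0 ?pi_ge0// invr_ge0. Qed.

(** For k >= K the sum of inverses starts at k and cancels |n_k|. The finitely many earlier
    frequencies are bounded by [B], with |n_l| >= 1 for l >= K. *)
Lemma rel_freq_sum : exists2 c : R, 0 <= c &
  forall k M, \sum_(r < M) rel_freq k (K + r) <= c.
Proof.
pose B : R := \sum_(k < K) `|(n k)%:~R|.
have B0 : 0 <= B by apply: sumr_ge0.
have p0 : 0 <= 2 * pi :> R by rewrite mulr_ge0// pi_ge0.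
have c0 : 0 <= 2 * pi * (3 * (1 + B)) by apply: mulr_ge0 => //; apply: mulr_ge0 => //; apply: addr_ge0.
exists (2 * pi * (3 * (1 + B))) => // k M.
have [kK|Kk] := ltnP k K.
  have kB : `|(n k)%:~R| <= B.
    by rewrite /B (bigD1 (Ordinal kK))//= lerDl; apply: sumr_ge0.
  under eq_bigr => r _ do rewrite /rel_freq (leq_trans kK (leq_addr _ _)) -mulrA.
  rewrite -!mulr_sumr; apply: ler_wpM2l => //.
  rewrite mulrC; apply: ler_pM => //.
  - by apply: sumr_ge0 => i _; rewrite invr_ge0.
  - apply: le_trans (sum_freq_inv _ (leqnn K)) _.
    by rewrite ler_piMr// invf_le1 ?freq_norm_ge1//; apply: lt_le_trans (freq_norm_ge1 (leqnn K)).
  - by apply: le_trans kB _; rewrite lerDr.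
have [p kp] : exists p, k = (K + p)%N by exists (k - K)%N; rewrite subnKC.
have [Mp|pM] := leqP M p.
  rewrite big1// => r _; rewrite /rel_freq ltnNge kp leq_add2l.
  by rewrite (leq_trans (ltnW (ltn_ord r)) Mp).
rewrite -(subnKC (ltnW pM)) big_split_ord /= big1 ?add0r; last first.
  by move=> r _; rewrite /rel_freq ltnNge kp leq_add2l (ltnW (ltn_ord r)).
apply: le_trans (_ : \sum_(r < M - p) (2 * pi * `|(n k)%:~R|) * `|(n (k + r))%:~R|^-1 <= _).
  apply: ler_sum => r _; rewrite /rel_freq addnA -kp; case: ifP => // _.
  by rewrite divr_ge0// mulr_ge0.
rewrite -mulr_sumr -mulrA; apply: ler_wpM2l => //.
apply: le_trans (_ : `|(n k)%:~R| * (3 * `|(n k)%:~R|^-1) <= _).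
  by apply: ler_wpM2l => //; exact: sum_freq_inv.
rewrite mulrCA divff ?mulr1; first by rewrite ler_peMr// lerDl.
by rewrite gt_eqF//; apply: lt_le_trans (freq_norm_ge1 Kk).
Qed.

(** * Sign multipliers on blocks and averages of partial sums *)

Variable A : nat.
Hypothesis A_gt0 : (0 < A)%N.

(* For fixed [a], the ends of the successive blocks; over all [a < A] and
   [0 < j] every index from [K + A] on occurs exactly once. *)
Definition cut a j : nat := if j is 0 then 0 else K + (j * A + a).

(** Past the last cut the multiplier keeps the sign [s J.+1] instead of vanishing, so that it stays
    unimodular and can be compared with a character. *)
Fixpoint sign_mult (s : nat -> C) a J k : C :=
  if J is J'.+1 then (if (cut a J <= k)%N then s J.+1 else sign_mult s a J' k)
  else s 1%N.

Lemma cut_le a j : (cut a j <= cut a j.+1)%N.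
Proof. by case: j => [|j]//=; rewrite leq_add2l leq_add2r leq_mul2r leqnSn orbT. Qed.

Lemma cut_bound a j : (a < A)%N -> (cut a j <= K + (j * A + A))%N.
Proof. by move=> aA; case: j => [|j] //=; rewrite !leq_add2l ltnW. Qed.

Lemma sign_mult_last s a J k : (cut a J <= k)%N -> sign_mult s a J k = s J.+1.
Proof. by case: J => [|J] //= ->. Qed.

(** Induction on the blocks. A sign change at the cut l adds a rotation by pi / n_l: it is exactly
    -1 at the frequencies of index k >= l, odd multiples of n_l, and within [rel_freq k l] of 1 at
    the lower ones. *)
Lemma sign_mult_rotation (s : nat -> C) a J : (forall j, s j = 1 \/ s j = -1) ->
  exists theta : R, exists2 sigma : C, normc sigma = 1 &
    forall k, normc (sign_mult s a J k - sigma * cis ((n k)%:~R * theta)) <=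
      \sum_(j < J) rel_freq k (cut a j.+1).
Proof.
move=> s1; have ns j : normc (s j) = 1 by have [->|->] := s1 j; rewrite ?normcN normc1.
elim: J => [|J [theta [sigma nsigma IH]]].
  exists 0; exists (s 1%N) => // k.
  by rewrite big_ord0 mulr0 cis0 mulr1 subrr normc0.
set l := cut a J.+1.
have Kl : (K <= l)%N by exact: leq_addr.
have [sE|sN] : s J.+2 = s J.+1 \/ s J.+2 = - s J.+1.
  by have [->|->] := s1 J.+2; have [->|->] := s1 J.+1; rewrite ?opprK; auto.
  exists theta; exists sigma => // k; rewrite big_ord_recr /=.
  apply: ler_wpDr; first exact: rel_freq_ge0.
  rewrite -/(cut a J.+1) -/l.
  by case: ifP => lk; rewrite ?sE -?(sign_mult_last s (leq_trans (cut_le a J) lk)).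
exists (theta + pi / (n l)%:~R); exists sigma => // k.
rewrite big_ord_recr /= -/(cut a J.+1) -/l mulrDr cisD.
have [lk|kl] := leqP l k.
  have [q oq qE] := freq_ratio n_odd Kl lk.
  have -> : (n k)%:~R * (pi / (n l)%:~R) = q%:~R * pi :> R.
    by rewrite qE intrM; field; exact: (freqR_neq0 _ n_odd).
  rewrite (cisMz_pi _ oq) mulrN1 mulrN opprK sN.
  rewrite -(sign_mult_last s (leq_trans (cut_le a J) lk)) -normcN opprD opprK.
  by rewrite ler_wpDr ?rel_freq_ge0// IH.
set x := cis _; set y := cis _.
have -> : sign_mult s a J k - sigma * (x * y) =
  (sign_mult s a J k - sigma * x) + - (sigma * x * (y - 1)) by ring.
apply: le_trans (le_normcD _ _) _; apply: lerD; first exact: IH.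
rewrite normcN !normcM nsigma normc_cis !mul1r.
apply: le_trans (normc_cis_sub1 _) _.
rewrite /rel_freq kl !normrM normfV (ger0_norm (pi_ge0 R)) le_eqVlt; apply/orP; left.
by apply/eqP; ring.
Qed.

Lemma psum_sum_expi N (f : E) t :
  psum N f (expi t) = \sum_(0 <= k < N) coef f k * cis ((n k)%:~R * t).
Proof. by rewrite psum_expi big_mkord. Qed.

(** The last term on the left fills the range from the final cut to N, so that the multiplier acts
    on the whole of [psum N f]. *)
Lemma sign_mult_sum (s : nat -> C) a J (f : E) t : forall N, (cut a J <= N)%N ->
  \sum_(j < J) s j.+1 * (psum (cut a j.+1) f (expi t) - psum (cut a j) f (expi t)) +
    s J.+1 * (psum N f (expi t) - psum (cut a J) f (expi t)) =
  \sum_(0 <= k < N) sign_mult s a J k * (coef f k * cis ((n k)%:~R * t)).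
Proof.
elim: J => [|J IH] N cN.
  rewrite big_ord0 add0r !psum_sum_expi big_nil subr0 mulr_sumr.
  by apply: eq_bigr.
rewrite big_ord_recr /= -/(cut a J.+1) (IH _ (cut_le a J)).
rewrite !psum_sum_expi (big_cat_nat (leq0n _) cN) /= [in RHS](big_cat_nat (leq0n _) cN) /=.
rewrite -/(cut a J.+1) [X in X - _]addrC addrK mulr_sumr; congr (_ + _).
  by apply: eq_big_nat => k /andP[_ kc]; rewrite leqNgt kc.
by apply: eq_big_nat => k /andP[ck _]; rewrite ck.
Qed.

(** The approximating character turns the multiplier into a rotation of [psum N f], up to a
    unimodular factor; the deviations are charged to the coefficients one by one. *)
Lemma signed_sum_cut (s : nat -> C) a J (f : E) t N : (forall j, s j = 1 \/ s j = -1) ->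
  (cut a J <= N)%N ->
  normc (\sum_(j < J) s j.+1 * (psum (cut a j.+1) f (expi t) - psum (cut a j) f (expi t)))
  <= sup_norm (psum N f) +
     \sum_(k < N) normc (coef f k) * \sum_(j < J) rel_freq k (cut a j.+1).
Proof.
move=> s1 cN; set D := \sum_(j < J) _.
pose st (tau : C) j : C := if (j <= J)%N then s j else tau.
set B := _ + _.
(* Stopping after J blocks is the average of continuing with +1 and with -1. *)
have bound tau : tau = 1 \/ tau = -1 ->
    normc (D + tau * (psum N f (expi t) - psum (cut a J) f (expi t))) <= B.
  move=> tau1.
  have st1 j : st tau j = 1 \/ st tau j = -1 by rewrite /st; case: ifP.
  have -> : D + tau * (psum N f (expi t) - psum (cut a J) f (expi t)) =
     \sum_(0 <= k < N) sign_mult (st tau) a J k * (coef f k * cis ((n k)%:~R * t)).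
    rewrite -sign_mult_sum//; congr (_ + _ * _); last by rewrite /st ltnn.
    by apply: eq_bigr => j _; rewrite /st ltn_ord.
  have [theta [sigma nsigma h]] := sign_mult_rotation a J st1.
  have -> : \sum_(0 <= k < N) sign_mult (st tau) a J k * (coef f k * cis ((n k)%:~R * t)) =
     sigma * psum N f (expi (t + theta)) +
     \sum_(k < N) (sign_mult (st tau) a J k - sigma * cis ((n k)%:~R * theta)) *
        (coef f k * cis ((n k)%:~R * t)).
    rewrite psum_expi big_mkord mulr_sumr -big_split /=; apply: eq_bigr => k _.
    by rewrite mulrDr cisD; ring.
  apply: le_trans (le_normcD _ _) _; apply: lerD.
    by rewrite normcM nsigma mul1r normc_le_sup_norm.
  apply: le_trans (_ : \sum_(k < N) normc ((sign_mult (st tau) a J k -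
      sigma * cis ((n k)%:~R * theta)) * (coef f k * cis ((n k)%:~R * t))) <= _).
    elim/big_ind2: _ => [|x y x' y' hx hy|//]; first by rewrite normc0.
    by apply: le_trans (le_normcD _ _) _; exact: lerD.
  apply: ler_sum => k _; rewrite !normcM normc_cis mulr1 mulrC.
  by apply: ler_wpM2l; [exact: normc_ge0|exact: h].
have h1 := bound 1 (or_introl erefl); have h2 := bound (-1) (or_intror erefl).
rewrite mul1r in h1; rewrite mulN1r in h2.
set X := psum N f _ - _ in h1 h2.
have hD : normc (D + X + (D - X)) <= B + B.
  by apply: le_trans (le_normcD _ _) _; exact: lerD.
have e : D + X + (D - X) = 2%:C * D by rewrite rmorph_nat; ring.
rewrite e normcM normc_real ger0_norm// in hD; lra.
Qed.

(** For j > 0 the lengths averaged are K + jA, ..., K + jA + A - 1; for j = 0 every cut is 0 and the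
    operator vanishes. *)
Definition block_mean j (f : E) : E := (A%:R^-1 : C) *: \sum_(a < A) psum (cut a j) f.

Lemma psum_linear N : linear (psum N : E -> E).
Proof.
move=> c f g; elim: N => [|N IH].
  by rewrite /psum !big_ord0 scaler0 add0r.
rewrite !psumS IH coef_lin scalerDl scalerDr !scalerA -!addrA; congr (_ + _).
by rewrite addrCA.
Qed.

Lemma block_mean_linear j : linear (block_mean j).
Proof.
move=> c f g; rewrite /block_mean scalerA mulrC -scalerA -scalerDr; congr (_ *: _).
rewrite scaler_sumr -big_split /=; apply: eq_bigr => a _; exact: psum_linear.
Qed.

HB.instance Definition _ j :=
  GRing.isLinear.Build R[i] E E *:%R (block_mean j) (@block_mean_linear j).

Lemma normc_invA : normc (A%:R^-1 : C) = A%:R^-1.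
Proof. by rewrite normcV -(rmorph_nat (real_complex R)) normc_real ger0_norm. Qed.

Lemma sup_norm_block_mean (u : 'I_A -> E) (b : R) : (forall a, sup_norm (u a) <= b) ->
  sup_norm ((A%:R^-1 : C) *: \sum_(a < A) u a) <= b.
Proof.
move=> ub; rewrite sup_normZ normc_invA ler_pdivrMl ?ltr0n//.
apply: le_trans (_ : \sum_(a < A) b <= _); last by rewrite sumr_const card_ord mulr_natl.
elim/big_ind2: _ => [|x y x' y' hx hy|a _]; last exact: ub.
  by apply: sup_norm_le => z; rewrite [X in normc X](_ : _ = 0) ?normc0.
by apply: le_trans (sup_normD _ _) _; exact: lerD.
Qed.

Lemma block_mean_cvg (f : E) : block_mean j f @[j --> \oo] --> f.
Proof.
apply/cvgrPdist_lt => _ /gt0_complexP[e e0 ->].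
have e20 : 0 < e / 2 by rewrite divr_gt0.
have [N0 hN0] := psum_cvg f e20.
(* Indices beyond [N0] exclude j = 0, and then every cut is at least j because A > 0. *)
exists N0.+1 => // j /= jN; rewrite C_E_normE ltcR.
have -> : f - block_mean j f = (A%:R^-1 : C) *: \sum_(a < A) (f - psum (cut a j) f).
  rewrite sumrB scalerBr sumr_const card_ord -scalerMnr scalerMnl -mulr_natr mulVf ?scale1r//.
  by rewrite pnatr_eq0 -lt0n.
apply: le_lt_trans (_ : e / 2 < _); last by lra.
apply: sup_norm_block_mean => a; apply/ltW/hN0; case: j jN => // j jN.
rewrite /cut; apply: leq_trans (ltnW jN) _; apply: leq_trans (leq_addl K _).
by apply: leq_trans (leq_addr _ _); rewrite leq_pmulr.
Qed.

Lemma block_mean_bounded j : bounded_operator (block_mean j).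
Proof.
have [c c0 hc] := coef_summable R n_inj n_odd.
exists c%:C => f; rewrite !C_E_normE -rmorphM lecR.
by apply: sup_norm_block_mean => a; apply: le_trans (sup_norm_psum _ _) (hc _ _).
Qed.

Lemma block_mean_finite_rank j : finite_rank (block_mean j).
Proof.
pose d := (K + (j * A + A))%N.
exists d; exists (fun k : 'I_d => chr R n k) => f.
(* The partial sums of different lengths are padded with zeros to the common length [d]. *)
exists (fun k : 'I_d => A%:R^-1 * \sum_(a < A) (if (k < cut a j)%N then coef f k else 0)).
rewrite /block_mean scaler_sumr; under [RHS]eq_bigr do rewrite -scalerA scaler_suml scaler_sumr.
rewrite exchange_big /=; apply: eq_bigr => a _; rewrite -scaler_sumr; congr (_ *: _).
have cd : (cut a j <= d)%N by exact: cut_bound.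
rewrite /psum (big_ord_widen _ (fun k => coef f k *: chr R n k) cd) big_mkcond /=.
by apply: eq_bigr => k _; case: ifP; rewrite ?scale0r.
Qed.

(** Over all shifts an index occurs as a cut at most once, so at each frequency the errors of the A
    shifts together stay below [c1]; the average divides this by A. *)
Lemma block_mean_signed_sum (c1 c2 : R) J (s : nat -> C) (f : E) :
  (forall k M, \sum_(r < M) rel_freq k (K + r) <= c1) -> 0 <= c1 ->
  (forall N, \sum_(k < N) normc (coef f k) <= c2 * sup_norm f) ->
  (forall k, s k = 1 \/ s k = -1) ->
  sup_norm (\sum_(1 <= k < J.+1) s k *: (block_mean k f - block_mean k.-1 f)) <=
    (1 + c1 * c2 / A%:R) * sup_norm f.
Proof.
move=> hc1 c10 hc2 s1; apply: sup_norm_le => z; have [t _ <-] := expi_surj z.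
apply/ler_addgt0Pr => e e0.
have [N0 hN0] := psum_cvg f e0.
(* N lies beyond every cut in use, and [psum N f] is within [e] of [f]. *)
pose N := maxn N0 (K + (J * A + A)).
have cN a : (a < A)%N -> (cut a J <= N)%N.
  move=> aA; apply: leq_trans (leq_maxr _ _).
  exact: cut_bound.
have psumN : sup_norm (psum N f) <= sup_norm f + e.
  have -> : psum N f = f + - (f - psum N f) by rewrite opprB addrC subrK.
  apply: le_trans (sup_normD _ _) _; rewrite sup_normN lerD2l ltW// hN0//.
  exact: leq_maxl.
pose D (a : nat) : C := \sum_(j < J) s j.+1 *
  (psum (cut a j.+1) f (expi t) - psum (cut a j) f (expi t)).
have evS (m : nat) (u : 'I_m -> E) x : (\sum_(i < m) u i) x = \sum_(i < m) u i x.
  elim: m u => [|m IH] u; first by rewrite !big_ord0.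
  by rewrite !big_ord_recr /= -IH.
have -> : (\sum_(1 <= k < J.+1) s k *: (block_mean k f - block_mean k.-1 f)) (expi t) =
    A%:R^-1 * \sum_(a < A) D a.
  rewrite big_add1 /= big_mkord evS /D exchange_big mulr_sumr; apply: eq_bigr => j _.
  rewrite -mulr_sumr mulrCA; congr (_ * _).
  by rewrite sumrB mulrBr -!evS.
rewrite normcM normc_invA ler_pdivrMl ?ltr0n//.
have hD a : (a < A)%N -> normc (D a) <= sup_norm f + e +
     \sum_(k < N) normc (coef f k) * \sum_(j < J) rel_freq k (cut a j.+1).
  move=> aA; apply: le_trans (signed_sum_cut f t s1 (cN a aA)) _.
  by rewrite lerD2r.
apply: le_trans (_ : \sum_(a < A) (sup_norm f + e +
     \sum_(k < N) normc (coef f k) * \sum_(j < J) rel_freq k (cut a j.+1)) <= _).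
  apply: le_trans (_ : \sum_(a < A) normc (D a) <= _).
    elim/big_ind2: _ => [|x y x' y' hx hy|//]; first by rewrite normc0.
    by apply: le_trans (le_normcD _ _) _; exact: lerD.
  by apply: ler_sum => a _; exact: hD.
rewrite big_split /= sumr_const card_ord exchange_big /=.
have A0 : A%:R != 0 :> R by rewrite pnatr_eq0 -lt0n.
have -> : A%:R * ((1 + c1 * c2 / A%:R) * sup_norm f + e) =
   (sup_norm f + e) *+ A + c1 * (c2 * sup_norm f).
  by rewrite -mulr_natl; field.
rewrite lerD2l; apply: le_trans (_ : \sum_(k < N) normc (coef f k) * c1 <= _); last first.
  by rewrite -mulr_suml mulrC; apply: ler_wpM2l => //; exact: hc2.
apply: ler_sum => k _; rewrite -mulr_sumr; apply: ler_wpM2l; first exact: normc_ge0.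
rewrite exchange_big /=.
have regroup (F : nat -> R) m : \sum_(j < m) \sum_(a < A) F (j * A + a)%N = \sum_(r < m * A) F r.
  elim: m => [|m IH]; first by rewrite !big_ord0.
  by rewrite big_ord_recr /= IH mulSn addnC big_split_ord.
(* The cuts have j from 1 to J; the nonnegative terms for j = 0 are added to obtain a full initial
   segment of indices. *)
apply: le_trans (hc1 k (J.+1 * A)%N).
rewrite -(regroup (fun r => rel_freq k (K + r)) J.+1) [leRHS]big_ord_recl /=.
apply: ler_wpDl; first by apply: sumr_ge0 => a _; exact: rel_freq_ge0.
by apply: ler_sum => j _.
Qed.

End umap.

(** * Choice of the averaging length and verification of real umap *)

Unset Implicit Arguments.
Set Strict Implicit.

Theorem proposition10p1p1 (R : realType) (n : nat -> int)
  (n_inj : injective n)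
  (n_ratio : \forall k \near \oo, exists q : int,
     odd `|q|%N /\ (n k.+1)%:~R / (n k)%:~R = q%:~R :> rat) :
  real_umap (C_E R (range n)).
Proof.
have [K _ hK] := n_ratio.
have n_odd k : (K <= k)%N -> n k != 0 /\ exists2 q : int, odd `|q|%N & n k.+1 = q * n k.
  move=> /hK[q [oq qE]].
  (* Division by 0 gives 0 in [rat], so a zero frequency would force q = 0, which is not odd. *)
  have nk0 : n k != 0.
    apply/eqP => nk0; move: qE; rewrite nk0 invr0 mulr0 => /esym/eqP.
    by rewrite intr_eq0 => /eqP q0; rewrite q0 in oq.
  split => //; exists q => //; apply: (@intr_inj rat).
  by rewrite intrM -qE divfK// intr_eq0.
have [c1 c10 hc1] := rel_freq_sum R n_inj n_odd.
have [c2 c20 hc2] := coef_summable R n_inj n_odd.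
move=> _ /gt0_complexP[e e0 ->].
(* A is large enough for the averaged error [c1 * c2 / A%:R] to be at most [e]. *)
pose A := (Num.truncn (c1 * c2 / e)).+1.
have A0 : (0 < A)%N by [].
have Ae : c1 * c2 / A%:R <= e.
  rewrite ler_pdivrMr ?ltr0n// [leRHS]mulrC -ler_pdivrMr//; apply: ltW.
  exact: truncnS_gt.
exists (fun j => block_mean K A j : {linear C_E R (range n) -> C_E R (range n)}); split.
- move=> y; rewrite /= /block_mean big1 ?scaler0// => a _.
  by rewrite /psum big_ord0.
- by move=> k; split; [exact: (block_mean_bounded _ n_inj n_odd A0)|exact: block_mean_finite_rank].
- by move=> y; exact: (block_mean_cvg n_inj n_odd A0).
- move=> J s s1 y; rewrite !C_E_normE.
  rewrite -(rmorph1 (real_complex R)) -rmorphD -rmorphM lecR.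
  apply: le_trans (block_mean_signed_sum n_inj n_odd A0 J hc1 c10 (fun N => hc2 y N) s1) _.
  by rewrite ler_wpM2r ?sup_norm_ge0// lerD2l.
Qed.
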